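(* Let $F$ be a field of characteristic not $2$ and let $n\ge1$. If $I_q^3F=0$, then every two isomorphic tensor products of $n$ quaternion algebras over $F$, $(c_1,d_1)\otimes\dots\otimes(c_n,d_n)\cong(c_1',d_1')\otimes\dots\otimes(c_n',d_n')$, are connected by a finite number of steps, where each step is either (1) $(c_k,d_k)\otimes(c_{k+1},d_{k+1})\rightarrow(c_k,(\beta^2-c_kc_{k+1})d_k)\otimes(c_{k+1},(\beta^2-c_kc_{k+1})d_{k+1})$ for some $k\in\{1,\dots,n-1\}$ and $\beta\in F$, or one of the following types: (2) $(c_k,d_k)\rightarrow((\alpha^2-\beta^2d_k)c_k,d_k)$, (3) $(c_k,d_k)\rightarrow(c_k,(\alpha^2-\beta^2c_k)d_k)$, for some $k\in\{1,\dots,n\}$ and $\alpha,\beta\in F$.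
   Context: For a field $F$ of characteristic not $2$ and $a,b\in F^\times$, $(a,b)$ denotes the quaternion algebra generated over $F$ by $x,y$ subject to $x^2=a$, $y^2=b$, $xy=-yx$; every quaternion algebra over $F$ is isomorphic to one of this form. Here a tensor product of $n$ quaternion algebras means a presentation $(c_1,d_1)\otimes\dots\otimes(c_n,d_n)$, i.e. an ordered list of pairs with $c_i,d_i\in F^\times$; two such are isomorphic if the resulting $F$-algebras (tensor products over $F$) are isomorphic. Two presentations are connected by a finite number of steps if one can pass from the first to the second through a finite sequence of presentations, each obtained from the preceding one by one of the listed steps, where factors not mentioned in a step are left unchanged; since all slots must lie in $F^\times$, a step is only allowed when the resulting slots are nonzero. $I_qF=I_q^1F$ is the group (under orthogonal sum $\perp$) of Witt equivalence classes of even-dimensional nondegenerate quadratic forms over $F$, where nondegenerate forms $q_1,q_2$ are Witt equivalent if one is isometric to the orthogonal sum of the other with a number of hyperbolic planes. For $m\ge2$, $I_q^mF$ is defined recursively as the subgroup generated by the classes of the forms $\langle1,-a\rangle\otimes q=q\perp(-a)q$ with $a\in F^\times$ and $q\in I_q^{m-1}F$. *)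

(* Defs.v *)
From HB Require Import structures.
From mathcomp Require Import all_boot all_order all_algebra all_field.
From mathcomp Require Import ring.
From Stdlib Require Import Relations.

Set Implicit Arguments.
Unset Strict Implicit.
Unset Printing Implicit Defensive.

Import GRing.Theory VectorInternalTheory.
Local Open Scope ring_scope.

(* A row (u_0, u_1, u_2, u_3) of quat a b stands for                          *)
(* u_0 + u_1 x + u_2 y + u_3 xy, where x ^ 2 = a, y ^ 2 = b and xy = - yx.    *)

Definition quat (F : fieldType) (a b : F) : Type := 'rV[F]_4.

HB.instance Definition _ (F : fieldType) (a b : F) := Vector.on (quat a b).

Section Quaternion.
Variables (F : fieldType) (a b : F).
Local Notation quat := (quat a b).

Definition quat_mk (r s t w : F) : quat := \row_(i < 4) [:: r; s; t; w]`_i.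

Definition quat_one : quat := quat_mk 1 0 0 0.

Definition quat_mul (u v : quat) : quat :=
  let: (u0, u1, u2, u3) := (u 0 0, u 0 1, u 0 2, u 0 3) in
  let: (v0, v1, v2, v3) := (v 0 0, v 0 1, v 0 2, v 0 3) in
  quat_mk (u0 * v0 + a * (u1 * v1) + b * (u2 * v2) - a * b * (u3 * v3))
          (u0 * v1 + u1 * v0 - b * (u2 * v3) + b * (u3 * v2))
          (u0 * v2 + u2 * v0 + a * (u1 * v3) - a * (u3 * v1))
          (u0 * v3 + u3 * v0 + u1 * v2 - u2 * v1).

Lemma quat_mkE r s t w :
  (quat_mk r s t w 0 0 = r) * (quat_mk r s t w 0 1 = s) *
  (quat_mk r s t w 0 2 = t) * (quat_mk r s t w 0 3 = w).
Proof. by rewrite !mxE. Qed.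

Lemma quatP (u v : quat) :
  u 0 0 = v 0 0 -> u 0 1 = v 0 1 -> u 0 2 = v 0 2 -> u 0 3 = v 0 3 -> u = v.
Proof.
move=> h0 h1 h2 h3; apply/rowP.
have E (w : quat) (i j : 'I_4) : val i = val j -> w 0 i = w 0 j.
  by move/val_inj->.
case=> [[|[|[|[|//]]]] lti]; set i := Ordinal lti.
- by rewrite (E u i 0) // (E v i 0).
- by rewrite (E u i 1) // (E v i 1).
- by rewrite (E u i 2) // (E v i 2).
- by rewrite (E u i 3) // (E v i 3).
Qed.

Fact quat_mulA : associative quat_mul.
Proof. by move=> u v w; apply: quatP; rewrite !quat_mkE; ring. Qed.

Fact quat_mul1 : left_id quat_one quat_mul.
Proof. by move=> u; apply: quatP; rewrite !quat_mkE; ring. Qed.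

Fact quat_mulr1 : right_id quat_one quat_mul.
Proof. by move=> u; apply: quatP; rewrite !quat_mkE; ring. Qed.

Fact quat_mulDl : left_distributive quat_mul +%R.
Proof. by move=> u v w; apply: quatP; rewrite !(quat_mkE, mxE) /=; ring. Qed.

Fact quat_mulDr : right_distributive quat_mul +%R.
Proof. by move=> u v w; apply: quatP; rewrite !(quat_mkE, mxE) /=; ring. Qed.

Fact quat_one_neq0 : quat_one != 0.
Proof.
apply/eqP => /(congr1 (fun u : 'rV[F]_4 => u 0 0)) /eqP.
by rewrite quat_mkE mxE oner_eq0.
Qed.

HB.instance Definition _ := GRing.Zmodule_isNzRing.Build quat
  quat_mulA quat_mul1 quat_mulr1 quat_mulDl quat_mulDr quat_one_neq0.

Fact quat_scaleAl (c : F) (u v : quat) : c *: (u * v) = (c *: u) * v.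
Proof. by apply: quatP; rewrite !(quat_mkE, mxE) /=; ring. Qed.

HB.instance Definition _ := GRing.Lmodule_isLalgebra.Build F quat quat_scaleAl.

Fact quat_scaleAr (c : F) (u v : quat) : c *: (u * v) = u * (c *: v).
Proof. by apply: quatP; rewrite !(quat_mkE, mxE) /=; ring. Qed.

HB.instance Definition _ := GRing.Lalgebra_isAlgebra.Build F quat quat_scaleAr.
HB.instance Definition _ := Algebra_isFalgebra.Build F quat.

Definition quat_x : quat := quat_mk 0 1 0 0.
Definition quat_y : quat := quat_mk 0 0 1 0.

Lemma quat_xx : quat_x * quat_x = a%:A.
Proof. by apply: quatP; rewrite !(quat_mkE, mxE) /=; ring. Qed.

Lemma quat_yy : quat_y * quat_y = b%:A.
Proof. by apply: quatP; rewrite !(quat_mkE, mxE) /=; ring. Qed.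

Lemma quat_xy : quat_x * quat_y = - (quat_y * quat_x).
Proof. by apply: quatP; rewrite !(quat_mkE, mxE) /=; ring. Qed.

Lemma quat_basis (u : quat) :
  u = (u 0 0)%:A + u 0 1 *: quat_x + u 0 2 *: quat_y
      + u 0 3 *: (quat_x * quat_y).
Proof. by apply: quatP; rewrite !(quat_mkE, mxE) /=; ring. Qed.

End Quaternion.

(* A matrix M in tensor A B stands for \sum_(i, j) M i j (e_i (x) f_j), where *)
(* (e_i) and (f_j) are the bases of A and B underlying v2r.                   *)

Section Tensor.
Variables (F : fieldType) (A B : falgType F).

Definition tensor : Type := 'M[F]_(dim A, dim B).

HB.instance Definition _ := Vector.on tensor.

Definition pure (x : A) (y : B) : tensor := (v2r x)^T *m v2r y.

Definition tbase (V : vectType F) (i : 'I_(dim V)) : V := r2v (delta_mx 0 i).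

Definition tensor_mul (M N : tensor) : tensor :=
  \sum_i \sum_j \sum_k \sum_l
    (M i j * N k l) *: pure (tbase i * tbase k) (tbase j * tbase l).

Lemma tbase_sum (V : vectType F) (v : V) : v = \sum_i v2r v 0 i *: tbase i.
Proof.
apply: (can_inj v2rK); rewrite linear_sum {1}[v2r v]row_sum_delta.
by apply: eq_bigr => i _; rewrite linearZ /= r2vK.
Qed.

Lemma pureDl x x' y : pure (x + x') y = pure x y + pure x' y.
Proof. by rewrite /pure !linearD /= mulmxDl. Qed.

Lemma pureDr x y y' : pure x (y + y') = pure x y + pure x y'.
Proof. by rewrite /pure linearD /= mulmxDr. Qed.

Lemma pureZl c x y : pure (c *: x) y = c *: pure x y.
Proof. by rewrite /pure !linearZ /= -scalemxAl. Qed.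

Lemma pureZr c x y : pure x (c *: y) = c *: pure x y.
Proof. by rewrite /pure linearZ /= -scalemxAr. Qed.

Lemma pure_suml (I : finType) (f : I -> A) y :
  pure (\sum_i f i) y = \sum_i pure (f i) y.
Proof. by rewrite /pure !linear_sum /= mulmx_suml. Qed.

Lemma pure_sumr (I : finType) x (f : I -> B) :
  pure x (\sum_i f i) = \sum_i pure x (f i).
Proof. by rewrite /pure linear_sum /= mulmx_sumr. Qed.

Lemma pure_tbase (i : 'I_(dim A)) (j : 'I_(dim B)) :
  pure (tbase i) (tbase j) = delta_mx i j.
Proof. by rewrite /pure !r2vK trmx_delta mul_delta_mx. Qed.

Lemma tensor_ind (P : tensor -> Prop) :
    P 0 -> (forall M N, P M -> P N -> P (M + N)) -> (forall x y, P (pure x y)) ->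
  forall M, P M.
Proof.
move=> P0 PD Pp M; rewrite [M]matrix_sum_delta.
apply: (big_ind P) => // i _; apply: (big_ind P) => // j _.
by rewrite -pure_tbase -pureZl.
Qed.

Fact tensor_mulDl : left_distributive tensor_mul +%R.
Proof.
move=> M M' N; rewrite /tensor_mul.
do 4![rewrite -big_split /=; apply: eq_bigr => ? _].
by rewrite mxE mulrDl scalerDl.
Qed.

Fact tensor_mulDr : right_distributive tensor_mul +%R.
Proof.
move=> N M M'; rewrite /tensor_mul.
do 4![rewrite -big_split /=; apply: eq_bigr => ? _].
by rewrite mxE mulrDr scalerDl.
Qed.

Fact tensor_scaleAl c M N : c *: tensor_mul M N = tensor_mul (c *: M) N.
Proof.
rewrite /tensor_mul; do 4![rewrite scaler_sumr; apply: eq_bigr => ? _].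
by rewrite mxE -mulrA scalerA.
Qed.

Fact tensor_scaleAr c M N : c *: tensor_mul M N = tensor_mul M (c *: N).
Proof.
rewrite /tensor_mul; do 4![rewrite scaler_sumr; apply: eq_bigr => ? _].
by rewrite mxE mulrCA scalerA.
Qed.

Lemma tensor_mul_pure x y x' y' :
  tensor_mul (pure x y) (pure x' y') = pure (x * x') (y * y').
Proof.
rewrite {2}(tbase_sum x) {2}(tbase_sum y) {2}(tbase_sum x') {2}(tbase_sum y').
rewrite mulr_suml pure_suml; apply: eq_bigr => i _.
rewrite mulr_suml pure_sumr; apply: eq_bigr => j _.
rewrite mulr_sumr pure_suml; apply: eq_bigr => k _.
rewrite mulr_sumr pure_sumr; apply: eq_bigr => l _.
rewrite -!scalerAl -!scalerAr !scalerA pureZl pureZr scalerA.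
by congr (_ *: _); rewrite !mxE !big_ord1 !mxE; ring.
Qed.

Lemma tensor_mul0l M : tensor_mul 0 M = 0.
Proof. by rewrite -[0](scale0r 0) -tensor_scaleAl !scale0r. Qed.

Lemma tensor_mul0r M : tensor_mul M 0 = 0.
Proof. by rewrite -[0](scale0r 0) -tensor_scaleAr !scale0r. Qed.

Fact tensor_mulA : associative tensor_mul.
Proof.
move=> M N P.
elim/tensor_ind: M => [|M M' IH IH'|x y]; first by rewrite !tensor_mul0l.
  by rewrite !tensor_mulDl IH IH'.
elim/tensor_ind: N => [|N N' IH IH'|x' y'].
- by rewrite tensor_mul0l tensor_mul0r tensor_mul0l.
- by rewrite !(tensor_mulDl, tensor_mulDr) IH IH'.
elim/tensor_ind: P => [|P P' IH IH'|x'' y'']; first by rewrite !tensor_mul0r.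
  by rewrite !tensor_mulDr IH IH'.
by rewrite !tensor_mul_pure !mulrA.
Qed.

Definition tensor_one : tensor := pure 1 1.

Fact tensor_mul1 : left_id tensor_one tensor_mul.
Proof.
elim/tensor_ind => [|M M' IH IH'|x y]; first exact: tensor_mul0r.
  by rewrite tensor_mulDr IH IH'.
by rewrite tensor_mul_pure !mul1r.
Qed.

Fact tensor_mulr1 : right_id tensor_one tensor_mul.
Proof.
elim/tensor_ind => [|M M' IH IH'|x y]; first exact: tensor_mul0l.
  by rewrite tensor_mulDl IH IH'.
by rewrite tensor_mul_pure !mulr1.
Qed.

Fact tensor_one_neq0 : tensor_one != 0.
Proof.
have neq0 (V : falgType F) : exists i, v2r (1 : V) 0 i != 0.
  by apply/rV0Pn; rewrite -(inj_eq (can_inj r2vK)) ?v2rK ?linear0 ?oner_neq0.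
have [i nzi] := neq0 A; have [j nzj] := neq0 B.
apply/eqP => /matrixP/(_ i j)/eqP.
by rewrite !mxE big_ord1 mxE mulf_eq0 (negPf nzi) (negPf nzj).
Qed.

HB.instance Definition _ := GRing.Zmodule_isNzRing.Build tensor
  tensor_mulA tensor_mul1 tensor_mulr1 tensor_mulDl tensor_mulDr tensor_one_neq0.
HB.instance Definition _ :=
  GRing.Lmodule_isLalgebra.Build F tensor tensor_scaleAl.
HB.instance Definition _ :=
  GRing.Lalgebra_isAlgebra.Build F tensor tensor_scaleAr.
HB.instance Definition _ := Algebra_isFalgebra.Build F tensor.

Lemma pureM x y x' y' : pure x y * pure x' y' = pure (x * x') (y * y').
Proof. exact: tensor_mul_pure. Qed.

Lemma pure1 : pure 1 1 = 1.
Proof. by []. Qed.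

End Tensor.

Definition isomorphic (F : fieldType) (A B : falgType F) : Prop :=
  exists f : {lrmorphism A -> B}, bijective f.

Section Presentations.
Variable F : fieldType.

(* The empty tensor product is F itself. *)
Fixpoint tensor_quat (s : seq (F * F)) : falgType F :=
  if s is (c, d) :: s' then tensor (quat c d) (tensor_quat s') else F^o.

Record presentation (n : nat) := Presentation {
  slots :> n.-tuple (F * F);
  slots_neq0 : all (fun p => (p.1 != 0) && (p.2 != 0)) slots
}.

(* The split s1 ++ ... ++ s2 locates the factor(s) on which a step acts. *)
Inductive elem_step : seq (F * F) -> seq (F * F) -> Prop :=
| ElemStep1 s1 s2 c d c' d' beta :
    elem_step
      (s1 ++ [:: (c, d); (c', d')] ++ s2)
      (s1 ++ [:: (c, (beta ^+ 2 - c * c') * d);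
                 (c', (beta ^+ 2 - c * c') * d')] ++ s2)
| ElemStep2 s1 s2 c d alpha beta :
    elem_step
      (s1 ++ [:: (c, d)] ++ s2)
      (s1 ++ [:: ((alpha ^+ 2 - beta ^+ 2 * d) * c, d)] ++ s2)
| ElemStep3 s1 s2 c d alpha beta :
    elem_step
      (s1 ++ [:: (c, d)] ++ s2)
      (s1 ++ [:: (c, (alpha ^+ 2 - beta ^+ 2 * c) * d)] ++ s2).

(* As p and q are presentations, the slots resulting from a step are nonzero. *)
Definition step n (p q : presentation n) : Prop := elem_step p q.

Definition connected n : presentation n -> presentation n -> Prop :=
  clos_refl_trans (presentation n) (@step n).

End Presentations.

Section QuadraticForms.
Variable F : fieldType.

Definition polar n (q : 'rV[F]_n -> F) (u v : 'rV[F]_n) : F :=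
  q (u + v) - q u - q v.

(* The polar form is symmetric, so linearity in one argument is bilinearity. *)
Definition quadratic n (q : 'rV[F]_n -> F) : Prop :=
  (forall c v, q (c *: v) = c ^+ 2 * q v) /\ (forall u, scalar (polar q u)).

Record qform := QForm {
  qdim : nat;
  qval :> 'rV[F]_qdim -> F;
  qvalP : quadratic qval
}.

Definition nondegenerate (q : qform) : Prop :=
  forall u, (forall v, polar q u v = 0) -> u = 0.

Definition isometric (q1 q2 : qform) : Prop :=
  exists f : {linear 'rV[F]_(qdim q1) -> 'rV[F]_(qdim q2)},
    bijective f /\ forall v, q2 (f v) = q1 v.

Fact qzero_subproof : quadratic (fun _ : 'rV[F]_0 => 0).
Proof.
split=> [c v | u c v w]; first by rewrite mulr0.
by rewrite /polar; ring.
Qed.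
Definition qzero : qform := QForm qzero_subproof.

Fact qhyp_subproof : quadratic (fun v : 'rV[F]_2 => v 0 0 * v 0 1).
Proof.
split=> [c v | u c v w]; first by rewrite !mxE; ring.
by rewrite /polar !mxE; ring.
Qed.
Definition hyperbolic_plane : qform := QForm qhyp_subproof.

Fact qscale_subproof (c : F) (q : qform) : quadratic (fun v => c * q v).
Proof.
have [qZ qL] := qvalP q; split=> [e v | u e v w]; first by rewrite qZ mulrCA.
have polE x y : polar (fun v => c * q v) x y = c * polar q x y.
  by rewrite /polar; ring.
by rewrite !polE qL mulrDr mulrCA.
Qed.
Definition qscale (c : F) (q : qform) : qform := QForm (qscale_subproof c q).

Fact qsum_subproof (q1 q2 : qform) :
  quadratic (fun v : 'rV[F]_(qdim q1 + qdim q2) => q1 (lsubmx v) + q2 (rsubmx v)).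
Proof.
have [qZ1 qL1] := qvalP q1; have [qZ2 qL2] := qvalP q2.
split=> [c v | u c v w]; first by rewrite !linearZ /= qZ1 qZ2 mulrDr.
have polE x y : polar (fun v => q1 (lsubmx v) + q2 (rsubmx v)) x y
    = polar q1 (lsubmx x) (lsubmx y) + polar q2 (rsubmx x) (rsubmx y).
  by rewrite /polar !linearD /=; ring.
by rewrite !polE !linearP /= qL1 qL2 /=; ring.
Qed.
Definition qsum (q1 q2 : qform) : qform := QForm (qsum_subproof q1 q2).

Definition add_hyperbolic (k : nat) (q : qform) : qform :=
  iter k (fun q' => qsum q' hyperbolic_plane) q.

Definition witt_equiv (q1 q2 : qform) : Prop :=
  exists k, isometric q1 (add_hyperbolic k q2)
         \/ isometric q2 (add_hyperbolic k q1).

(* A set of Witt classes is represented by the predicate on forms q telling   *)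
(* whether the class of q is in it; the opposite of the class of q is the     *)
(* class of -q. All forms here are nondegenerate as soon as those in S are.   *)
Inductive witt_generated (S : qform -> Prop) : qform -> Prop :=
| WittGen q : S q -> witt_generated S q
| WittZero : witt_generated S qzero
| WittAdd q1 q2 : witt_generated S q1 -> witt_generated S q2 ->
    witt_generated S (qsum q1 q2)
| WittOpp q : witt_generated S q -> witt_generated S (qscale (-1) q)
| WittEquiv q1 q2 : witt_generated S q1 -> witt_equiv q1 q2 ->
    witt_generated S q2.

(* Iq m is I_q^m F for m >= 1; Iq 0, which is not used, is set to be Iq 1. *)
Fixpoint Iq (m : nat) : qform -> Prop :=
  match m with
  | (m'.+1 as m1).+1 => witt_generated (fun q =>
      exists a q0, [/\ a != 0, Iq m1 q0 & q = qsum q0 (qscale (- a) q0)])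
  | _ => fun q => nondegenerate q /\ ~~ odd (qdim q)
  end.

Definition Iq_trivial (m : nat) : Prop :=
  forall q, Iq m q -> witt_equiv q qzero.

End QuadraticForms.

(* Main.v *)
Require Import Defs.
From Stdlib Require Import Relations.
From HB Require Import structures.
From mathcomp Require Import all_boot all_order all_algebra all_field.
From mathcomp Require Import ring zify generic_quotient boolp.

Set Implicit Arguments.
Unset Strict Implicit.
Unset Printing Implicit Defensive.

Import GRing.Theory VectorInternalTheory.
Local Open Scope ring_scope.

(** A presentation (c_1, d_1), ..., (c_n, d_n) has a sum of Pfister forms
    e = <<c_1, d_1>> + ... + <<c_n, d_n>> in the Witt ring, where
    <<c, d>> = <1, -c> <1, -d>; the hypothesis on the third power of the
    fundamental ideal says that <<a, b>> <1, -c> = 0 for all a, b, c. The proof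
    has two halves: e determines the presentation up to steps, and the algebra
    determines e.

    First half. To a diagonal form <b, x, y, ...> of odd dimension 2n + 1 attach
    the presentation whose first factor is (-bx, -by) and whose remaining ones
    come from <-bxy, ...> [pres]. Replacing two adjacent entries p, q of the form
    by p m, q m with m a value of <1, pq> changes the presentation by steps:
    inside a factor these are [ElemStep2] and [ElemStep3], and across two factors
    exactly [ElemStep1] [chain_sconn]. By Witt's chain equivalence theorem
    [represents_chain], isometric diagonal forms are connected by such moves, so
    isometric forms give connected presentations. Conversely every presentation
    comes from a form whose Witt class is e + 1 [wclass_slot_form]. Two
    presentations of the same length with the same e thus come from forms of the
    same dimension and Witt class, which are isometric by Witt cancellation
    [symbol_sum_sconn].

    Second half. If the algebras A of p and B of q are isomorphic, then B acts on
    itself on the left through A and on the right, so the concatenation p ++ q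
    has matrices of size 4 ^ n satisfying its relations [isomorphic_module]:
    tensor products of 2n quaternion algebras have no smaller nonzero modules, and
    one of dimension 4 ^ n exists only if the algebra is split. It remains to see
    that e = 0 for split presentations [split_symbol_sum]; then e(p) + e(q) = 0,
    and e(q) is its own opposite, so e(p) = e(q).

    The proof that e = 0 is by induction on the number m of factors. Let (c, d)
    be the first one and s the others. If c = r ^ 2, then <<c, d>> = 0 and an
    eigenspace of the generator of square c is a module for s of half the
    dimension [has_module_split]. If c is not a square, let K = F(sqrt c). The
    same eigenspace argument over K and the induction hypothesis give e(s) = 0
    over K, whence e(s) = <1, -c> t for some form t over F [wclass_ext_eq0]. A
    discriminant computation shows that t has even dimension [symbol_sum_even],
    so that e(s) = <<c, x>> for some x [pfister_common_slot], and the sum for the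
    whole presentation is <<c, d x>>. By the first half the presentation is then
    connected to (1, 1), ..., (1, 1), (c, d x); steps preserve modules, hence
    (c, d x) acts on a plane and <<c, d x>> = 0 [has_module2_pfister].
    The induction hypothesis over K requires that the vanishing of all
    <<a, b>> <1, -c> passes from F to K [pfister3_zero_ext]. *)

(** * Diagonal forms: chain equivalence and Witt cancellation *)

Section Chain.
Variable F : fieldType.
Implicit Types (a b c r x y : F) (s t u : seq F) (f g h : nat -> F).

Definition nonzero s := all (fun x => x != 0) s.

(** The binary rule is the isometry of <a, b> with <n a, n b> for a nonzero value
    n of <1, ab>; keeping the moves adjacent and in this multiplicative form is
    what lets them be read as steps on presentations. *)
Inductive chain : seq F -> seq F -> Prop :=
| ChainRefl s : chain s s
| ChainTrans s t u : chain s t -> chain t u -> chain s u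
| ChainSquare r a s : r != 0 -> chain (a :: s) (r ^+ 2 * a :: s)
| ChainBinary x y a b s : x ^+ 2 + a * b * y ^+ 2 != 0 ->
    chain (a :: b :: s)
      ((x ^+ 2 + a * b * y ^+ 2) * a :: (x ^+ 2 + a * b * y ^+ 2) * b :: s)
| ChainCons a s t : chain s t -> chain (a :: s) (a :: t).

(** The inverse of the value n = x^2 + ab y^2 is again such a value, because
    1 / n = n / n^2. *)
Lemma chain_sym s t : chain s t -> chain t s.
Proof.
elim=> {s t} [s|s t u _ ts _ ut|r a s r0|x y a b s|a s t _ ts].
- exact: ChainRefl.
- exact: ChainTrans ut ts.
- have := @ChainSquare r^-1 (r ^+ 2 * a) s; rewrite invr_eq0 => /(_ r0).
  by congr (chain _ (_ :: _)); field.
- set n := _ + _ => n0.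
  have E : (x / n) ^+ 2 + (n * a) * (n * b) * (y / n ^+ 2) ^+ 2 = n^-1.
    transitivity ((x ^+ 2 + a * b * y ^+ 2) / n ^+ 2); first by field.
    by rewrite -/n; field.
  have := @ChainBinary (x / n) (y / n ^+ 2) (n * a) (n * b) s.
  by rewrite E invr_eq0 !mulKf //; apply.
- exact: ChainCons.
Qed.

Lemma chain_size s t : chain s t -> size s = size t.
Proof. by elim=> //= [? ? ? _ -> _ ->|? ? ? _ ->]. Qed.

Lemma chain_nonzero s t : chain s t -> nonzero s -> nonzero t.
Proof.
rewrite /nonzero.
elim=> //= [? ? ? _ st _ tu /st/tu|r a u r0|x y a b u n0|a ? ? _ IH] //.
- by rewrite mulf_eq0 negb_or expf_neq0.
- by rewrite !mulf_eq0 !negb_or n0.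
- by case/andP=> -> /IH.
Qed.

Lemma chain_catl s t u : chain s t -> chain (u ++ s) (u ++ t).
Proof. by move=> st; elim: u => //= a u; apply: ChainCons. Qed.

Lemma chain_catr s t u : chain s t -> chain (s ++ u) (t ++ u).
Proof.
elim=> {s t} [s|s v t _ sv _ vt|r a s r0|x y a b s n0|a s t _ st] /=.
- exact: ChainRefl.
- exact: ChainTrans sv vt.
- exact: ChainSquare.
- exact: ChainBinary.
- exact: ChainCons.
Qed.

Lemma chain_cat s t s' t' :
  chain s t -> chain s' t' -> chain (s ++ s') (t ++ t').
Proof.
by move=> st st'; apply: ChainTrans (chain_catl _ st') (chain_catr _ st).
Qed.

(** Any nonzero value of <a, b> can be made its first entry; the second one is then
    forced by the determinant, up to squares. *)
Lemma chain_binary_value a b x y : a != 0 -> b != 0 ->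
  a * x ^+ 2 + b * y ^+ 2 != 0 -> forall s,
  chain (a :: b :: s)
    (a * x ^+ 2 + b * y ^+ 2 :: a * b * (a * x ^+ 2 + b * y ^+ 2) :: s).
Proof.
move=> a0 b0 n0 s; set n := _ + _ in n0 *.
have E : x ^+ 2 + a * b * (y / a) ^+ 2 = n / a by rewrite /n; field.
have := @ChainBinary x (y / a) a b s; rewrite E mulf_eq0 invr_eq0 negb_or n0 a0.
rewrite divfK // => /(_ isT) /ChainTrans; apply.
have := @ChainSquare a (n / a * b) s a0 => /ChainCons.
by move/(_ n); congr (chain _ (_ :: _ :: _)); field.
Qed.

(** Swapping is the case of the value b = a 0^2 + b 1^2. *)
Lemma chain_swap a b s : a != 0 -> b != 0 -> chain (a :: b :: s) (b :: a :: s).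
Proof.
move=> a0 b0; have := @chain_binary_value a b 0 1 a0 b0.
rewrite expr0n expr1n mulr0 add0r mulr1 => /(_ b0 s)/ChainTrans; apply.
have bV : b^-1 != 0 by rewrite invr_eq0.
have := ChainCons b (@ChainSquare b^-1 (a * b * b) s bV).
by congr (chain _ (_ :: _ :: _)); field.
Qed.

Lemma chain_rcons a s : a != 0 -> nonzero s -> chain (a :: s) (rcons s a).
Proof.
move=> a0; elim: s => [_|b s IH /= /andP[b0 s0]]; first exact: ChainRefl.
apply: ChainTrans (chain_swap s a0 b0) _.
by apply: ChainCons; exact: IH.
Qed.

Lemma chain_catC s t : nonzero s -> nonzero t -> chain (s ++ t) (t ++ s).
Proof.
elim: s t => [|a s IH] t /=; first by rewrite cats0 => *; exact: ChainRefl.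
case/andP=> a0 s0 t0.
have: nonzero (s ++ t) by rewrite /nonzero all_cat; apply/andP.
move/(chain_rcons a0)/ChainTrans; apply.
rewrite rcons_cat; apply: ChainTrans (IH _ s0 _) _.
  by rewrite /nonzero all_rcons a0.
by rewrite cat_rcons; exact: ChainRefl.
Qed.

Lemma chain_perm s t : perm_eq s t -> nonzero s -> chain s t.
Proof.
move=> st s0.
suff: chain s t /\ nonzero t by case.
apply: (@catCA_perm_ind _ (fun t => chain s t /\ nonzero t) _ s t st); last first.
  by split => //; exact: ChainRefl.
move=> s1 s2 s3; rewrite /nonzero !all_cat => -[sC /and3P[s10 s20 s30]].
split; last by rewrite s10 s20.
by apply: ChainTrans sC _; rewrite !catA; apply/chain_catr/chain_catC.
Qed.

(** Vectors are functions on nat of which a form of dimension n reads the first n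
    values; this avoids dependent dimensions in inductions on lists. *)
Definition shift f : nat -> F := fun i => f i.+1.
Definition consv x f : nat -> F := fun i => if i is j.+1 then f j else x.

Fixpoint bil s f g : F :=
  if s is a :: s' then a * f 0%N * g 0%N + bil s' (shift f) (shift g) else 0.

Lemma bil_sym s f g : bil s f g = bil s g f.
Proof. by elim: s f g => //= a s IH f g; rewrite IH mulrAC. Qed.

Lemma bil_linl s c f h g :
  bil s (fun i => c * f i + h i) g = c * bil s f g + bil s h g.
Proof.
elim: s f h g => [|a s IH] f h g /=; first by rewrite mulr0 addr0.
by rewrite [bil s (shift _) _]IH; ring.
Qed.

Lemma bil_linr s c f h g :
  bil s g (fun i => c * f i + h i) = c * bil s g f + bil s g h.
Proof. by rewrite bil_sym bil_linl !(bil_sym s g). Qed.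

(** T is an isometric embedding of the space of t into that of s; the preservation
    of the bilinear form is the property that composes, transports values and
    cancels. *)
Definition represents s t :=
  exists T : (nat -> F) -> nat -> F, forall f g, bil s (T f) (T g) = bil t f g.

Lemma represents_trans s t u : represents s t -> represents t u -> represents s u.
Proof. by case=> T hT [T' hT']; exists (T \o T') => f g /=; rewrite hT. Qed.

Lemma chain_represents s t : chain s t -> represents s t.
Proof.
elim=> {s t} [s|s t u _ st _ tu|r a s r0|x y a b s|a s t _ [T hT]].
- by exists id.
- exact: represents_trans tu.
- by exists (fun f => consv (r * f 0%N) (shift f)) => f g /=; ring.
- set n := _ + _ => n0.
  exists (fun f => consv (x * f 0%N - b * y * f 1%N)
     (consv (x * f 1%N + a * y * f 0%N) (shift (shift f)))) => f g /=.
  by rewrite /n /shift /=; ring.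
- exists (fun f => consv (f 0%N) (T (shift f))) => f g /=.
  by rewrite [bil s _ _]hT.
Qed.

Hypothesis char2 : 2%:R != 0 :> F.

(** Witt cancellation. With e the image of the first basis vector and w(u) that of
    u, the map sending u to the part of w(u) outside the first coordinate, corrected
    by a multiple of the same part of e, is isometric: it is Witt's
    reflection argument in coordinates. *)
Lemma represents_cancel b s t : b != 0 -> represents (b :: s) (b :: t) -> represents s t.
Proof.
move=> b0 [T hT].
pose e := T (consv 1 (fun=> 0)).
pose m := e 0%N; pose r := shift e.
have bil0 u f : bil u f (fun=> 0) = 0.
  by elim: u f => //= a u IH f; rewrite [bil u _ _]IH; ring.
have ee : b * m * m + bil s r r = b.
  by rewrite -[LHS]/(bil (b :: s) e e) hT /= [bil t _ _]bil0; ring.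
(* The coefficient of the correction solves a quadratic equation with roots
   1 / (1 - m) and -1 / (1 + m); at most one of them is undefined. *)
have [l hl] : exists l, l ^+ 2 * (1 - m ^+ 2) - 2 * m * l - 1 = 0.
  have [m1|m1] := eqVneq m 1.
    by exists (- 2%:R^-1); rewrite m1; field.
  have {}m1 : 1 - m != 0 by rewrite subr_eq0 eq_sym.
  by exists (1 - m)^-1; field.
pose w f := T (consv 0 f).
have we f : b * w f 0%N * m + bil s (shift (w f)) r = 0.
  by rewrite -[LHS]/(bil (b :: s) (w f) e) hT /= [bil t _ _]bil0; ring.
have ww f g : b * w f 0%N * w g 0%N + bil s (shift (w f)) (shift (w g)) = bil t f g.
  by rewrite -[LHS]/(bil (b :: s) (w f) (w g)) hT /= mulr0 add0r.
exists (fun f i => (l * w f 0%N) * r i + shift (w f) i) => f g.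
rewrite !(bil_linl, bil_linr) (bil_sym s r (shift _)) -ww.
move: (we f) (we g) ee; set B1 := bil s _ r; set B2 := bil s _ r; set B3 := bil s r r.
move=> /addr0_eq E1 /addr0_eq E2 E3.
have {}E3 : B3 = b - b * m * m by rewrite -{1}E3; ring.
rewrite -E1 -E2 E3; apply/eqP; rewrite -subr_eq0; apply/eqP.
transitivity (b * w f 0%N * w g 0%N * (l ^+ 2 * (1 - m ^+ 2) - 2 * m * l - 1)).
  by ring.
by rewrite hl mulr0.
Qed.

(** Besides splitting off the value of a vector f, this records that the remaining
    form takes all the values of q on the orthogonal of f, so that a second
    orthogonal vector can be split off next. *)
Lemma chain_split_value s f : nonzero s -> bil s f f != 0 ->
  exists s', chain s (bil s f f :: s') /\
    forall g, bil s g f = 0 -> exists h, bil s' h h = bil s g g.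
Proof.
elim: s f => [|a s IH] f /=; first by rewrite eqxx.
case/andP=> a0 s0; set x := f 0%N; set f' := shift f.
have -> : a * x * x = a * x ^+ 2 by ring.
have [r0|r0] := eqVneq (bil s f' f') 0.
  rewrite r0 addr0 mulf_eq0 negb_or a0 /= => x20.
  have x0 : x != 0 by apply: contraNneq x20 => ->; rewrite expr0n.
  (* The part f' of f is isotropic; moving g along f' replaces its first
     coordinate without changing its value. *)
  exists s; split; first by rewrite mulrC; exact: ChainSquare.
  move=> g; set g' := shift g => E.
  exists (fun i => (- (g 0%N / (2%:R * x))) * f' i + g' i).
  rewrite !(bil_linl, bil_linr) r0 (bil_sym _ f').
  have -> : bil s g' f' = - (a * g 0%N * x) by apply/eqP; rewrite -addr_eq0 addrC E.
  by field; rewrite x0.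
have [s' [ss' hs']] := IH _ s0 r0; set r := bil s f' f' in r0 ss' *.
have nz' : nonzero (r :: s') := chain_nonzero ss' s0.
rewrite -[r]mulr1 -(expr1n F 2) => b0.
exists (a * r * (a * x ^+ 2 + r * 1 ^+ 2) :: s'); split.
  apply: ChainTrans (ChainCons a ss') _; exact: chain_binary_value.
move=> g; set g' := shift g => E.
(* The component of g' orthogonal to f'. *)
pose k i := (- (bil s g' f' / r)) * f' i + g' i.
have kf : bil s k f' = 0 by rewrite bil_linl mulNr divfK // addNr.
have [h hE] := hs' k kf; exists (consv (- (g 0%N / r)) h) => /=.
rewrite [bil s' _ _]hE !(bil_linl, bil_linr) -/r (bil_sym _ f').
have -> : bil s g' f' = - (a * g 0%N * x) by apply/eqP; rewrite -addr_eq0 addrC E.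
by rewrite expr1n; field.
Qed.

Lemma chain_split_pair s f g : nonzero s -> bil s f f != 0 -> bil s g g != 0 ->
  bil s g f = 0 -> exists s', chain s (bil s f f :: bil s g g :: s').
Proof.
move=> s0 f0 g0 fg; have [s' [ss' hs]] := chain_split_value s0 f0.
have [h hE] := hs g fg; rewrite -hE in g0 *.
have /andP[_ s'0] := chain_nonzero ss' s0.
have [s'' [ss'' _]] := chain_split_value s'0 g0.
by exists s''; apply: ChainTrans ss' (ChainCons _ ss'').
Qed.

(** Witt's chain equivalence theorem: split off the first entry of t from s, cancel
    it, and repeat. *)
Lemma represents_chain s t :
  size s = size t -> nonzero s -> nonzero t -> represents s t -> chain s t.
Proof.
elim: t s => [|b t IH] s /=; first by move/size0nil-> => *; exact: ChainRefl.
move=> sz s0 /andP[b0 t0] st; case: (st) => T hT.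
pose e := consv 1 (fun=> 0 : F).
have eb : bil (b :: t) e e = b.
  have bil0 u : bil u (fun=> 0) (fun=> 0) = 0.
    by elim: u => //= a u IHu; rewrite [bil u _ _]IHu; ring.
  by rewrite /= [bil t _ _]bil0; ring.
have Te0 : bil s (T e) (T e) != 0 by rewrite hT eb.
have [s' [ss' _]] := chain_split_value s0 Te0; rewrite hT eb in ss'.
have /andP[_ s'0] := chain_nonzero ss' s0.
apply: ChainTrans (ss') (ChainCons _ _); apply: IH => //.
  by have := chain_size ss'; rewrite sz => -[].
by apply: (represents_cancel b0); apply: represents_trans (chain_represents (chain_sym ss')) st.
Qed.

Lemma chain_cancel a s t : nonzero (a :: s) -> chain (a :: s) (a :: t) -> chain s t.
Proof.
move=> nzs st; have /andP[_ t0] := chain_nonzero st nzs.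
case/andP: nzs => a0 s0.
have [sz] := chain_size st.
exact: represents_chain sz s0 t0 (represents_cancel a0 (chain_represents st)).
Qed.

Lemma chain_cancel_cat u s t :
  nonzero u -> nonzero s -> chain (u ++ s) (u ++ t) -> chain s t.
Proof.
move=> u0 s0; elim: u u0 => //= a u IH /andP[a0 u0] st.
apply: (IH u0); apply: (chain_cancel _ st).
by rewrite /nonzero /= all_cat a0 -!/(nonzero _) u0.
Qed.

(** For forms with nonzero entries the second condition says that f is nonzero on
    the coordinates that s reads; stated through a vector g it transports along
    isometries and field extensions. *)
Definition isotropic s := exists f g, bil s f f = 0 /\ bil s g f != 0.

(** A nonzero isotropic vector lies in a hyperbolic plane, which contains orthogonal
    vectors of values 1 and -1. *)
Lemma isotropic_split s :
  nonzero s -> isotropic s -> exists s', chain s (1 :: -1 :: s').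
Proof.
move=> s0 [f [g' [ff g'f]]].
have [g gf] : exists g, bil s g f = 1.
  exists (fun i => (bil s g' f)^-1 * g' i + f i).
  by rewrite bil_linl ff mulVf // addr0.
have fg : bil s f g = 1 by rewrite bil_sym.
have [e [ee ef]] : exists e, bil s e e = 0 /\ bil s e f = 1.
  exists (fun i => (- (bil s g g / 2%:R)) * f i + g i).
  by rewrite !(bil_linl, bil_linr) ff gf fg; split; [field | ring].
have fe : bil s f e = 1 by rewrite bil_sym.
pose p i := 2%:R^-1 * f i + e i; pose m i := (- 2%:R^-1) * f i + e i.
have pp : bil s p p = 1 by rewrite !(bil_linl, bil_linr) ff ef fe ee; field.
have mm : bil s m m = -1 by rewrite !(bil_linl, bil_linr) ff ef fe ee; field.
have mp : bil s m p = 0 by rewrite !(bil_linl, bil_linr) ff ef fe ee; field.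
have := @chain_split_pair s p m s0; rewrite pp mm oppr_eq0 oner_eq0.
exact.
Qed.

Lemma split_isotropic s s' : chain s (1 :: -1 :: s') -> isotropic s.
Proof.
move/chain_represents=> [T hT].
have bil0 u f : bil u f (fun=> 0) = 0.
  by elim: u f => //= a u IHu f; rewrite [bil u _ _]IHu; ring.
pose e x y := consv x (consv y (fun=> 0 : F)).
have E x y x' y' : bil (1 :: -1 :: s') (e x y) (e x' y') = x * x' - y * y'.
  by rewrite /= [bil s' _ _]bil0 /shift /=; ring.
exists (T (e 1 1)), (T (e 1 0)); rewrite !hT !E !mulr1 subr0 subrr.
by rewrite oner_eq0.
Qed.

(** The value 1 of <a, -a> comes from a (u^2 - v^2) = a (u - v) (u + v) with
    u - v = 1 and u + v = 1 / a. *)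
Lemma chain_hyp a s : a != 0 -> chain (a :: - a :: s) (1 :: -1 :: s).
Proof.
move=> a0.
have E : a * ((1 + a^-1) / 2%:R) ^+ 2 + - a * ((a^-1 - 1) / 2%:R) ^+ 2 = 1.
  by field; rewrite char2.
have := @chain_binary_value a (- a) ((1 + a^-1) / 2%:R) ((a^-1 - 1) / 2%:R) a0.
rewrite E oppr_eq0 a0 oner_eq0 => /(_ isT isT s)/ChainTrans; apply; apply: ChainCons.
have aV : a^-1 != 0 by rewrite invr_eq0.
by have := @ChainSquare a^-1 (a * - a * 1) s aV; congr (chain _ (_ :: _)); field.
Qed.

End Chain.

(** * The Witt ring of diagonal forms *)

Section Witt.
Local Open Scope quotient_scope.
Variable F : fieldType.
Implicit Types (a b c r : F) (s t u l : seq F).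

(** Zero entries are dropped, so that every list has a class in the Witt ring and
    the class of <ab> is multiplicative for all a and b. *)
Definition drop0 s := [seq x <- s | x != 0].
Definition hyp_pairs s := flatten [seq [:: a; - a] | a <- s].

(** Stabilizing by planes <a, -a> rather than <1, -1> makes the group laws hold
    without dividing by 2. *)
Definition witt s t := exists l l', [/\ nonzero l, nonzero l'
  & chain (drop0 s ++ hyp_pairs l) (drop0 t ++ hyp_pairs l')].

Lemma drop0_nonzero s : nonzero (drop0 s).
Proof. exact: filter_all. Qed.

Lemma hyp_pairs_nonzero l : nonzero l -> nonzero (hyp_pairs l).
Proof. by elim: l => //= a l IH /andP[a0 /IH]; rewrite oppr_eq0 a0. Qed.

Lemma hyp_pairs_cat l l' : hyp_pairs (l ++ l') = hyp_pairs l ++ hyp_pairs l'.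
Proof. by rewrite /hyp_pairs map_cat flatten_cat. Qed.

Lemma drop0_cat s t : drop0 (s ++ t) = drop0 s ++ drop0 t.
Proof. exact: filter_cat. Qed.

Lemma drop0_id s : nonzero s -> drop0 s = s.
Proof. by move=> s0; apply/all_filterP. Qed.

Lemma nonzero_cat s t : nonzero (s ++ t) = nonzero s && nonzero t.
Proof. exact: all_cat. Qed.

Lemma witt_refl s : witt s s.
Proof. by exists [::], [::]; split=> //; exact: ChainRefl. Qed.

Lemma witt_sym s t : witt s t -> witt t s.
Proof. by case=> l [l' [l0 l'0 /chain_sym st]]; exists l', l. Qed.

Lemma witt_trans s t u : witt s t -> witt t u -> witt s u.
Proof.
case=> l [l' [l0 l'0 st]] [k [k' [k0 k'0 tu]]].
exists (l ++ k), (l' ++ k'); rewrite !nonzero_cat l0 l'0 k0 k'0; split=> //.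
rewrite !hyp_pairs_cat; rewrite catA; apply: ChainTrans (chain_catr _ st) _.
apply: (ChainTrans (t := (drop0 t ++ hyp_pairs k) ++ hyp_pairs l')).
  rewrite -!catA; apply/chain_catl/chain_catC; exact: hyp_pairs_nonzero.
apply: ChainTrans (chain_catr _ tu) _.
rewrite -!catA; apply/chain_catl/chain_catC; exact: hyp_pairs_nonzero.
Qed.

Definition wittb : rel (seq F) := fun s t => `[< witt s t >].

Lemma wittb_refl : reflexive wittb.
Proof. by move=> s; apply/asboolP/witt_refl. Qed.
Lemma wittb_sym : symmetric wittb.
Proof. by move=> s t; apply/asboolP/asboolP; exact: witt_sym. Qed.
Lemma wittb_trans : transitive wittb.
Proof. by move=> t s u /asboolP st /asboolP tu; apply/asboolP/(witt_trans st). Qed.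

Canonical wittb_equiv := EquivRel wittb wittb_refl wittb_sym wittb_trans.

Definition wittRing := {eq_quot wittb}.
HB.instance Definition _ := Choice.on wittRing.
HB.instance Definition _ := EqQuotient.on wittRing.

Definition wclass s : wittRing := \pi_wittRing s.

Lemma wclassP s t : wclass s = wclass t <-> witt s t.
Proof.
split=> [/eqmodP/asboolP //|st]; apply/eqmodP/asboolP => //.
Qed.

Lemma wittW (P : wittRing -> Prop) : (forall s, P (wclass s)) -> forall x, P x.
Proof. by move=> H; elim/quotW. Qed.

Lemma wclass_repr (x : wittRing) : wclass (repr x) = x.
Proof. exact: reprK. Qed.

Definition wadd (x y : wittRing) := wclass (repr x ++ repr y).
Definition wopp (x : wittRing) := wclass (map -%R (repr x)).

Lemma wadd_class s t : wadd (wclass s) (wclass t) = wclass (s ++ t).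
Proof.
apply/wclassP.
have [l [l' [l0 l'0 sC]]] : witt (repr (wclass s)) s by apply/wclassP/wclass_repr.
have [k [k' [k0 k'0 tC]]] : witt (repr (wclass t)) t by apply/wclassP/wclass_repr.
exists (l ++ k), (l' ++ k'); rewrite !nonzero_cat l0 l'0 k0 k'0; split=> //.
rewrite !drop0_cat !hyp_pairs_cat.
apply: (ChainTrans (t := (drop0 (repr (wclass s)) ++ hyp_pairs l) ++
                         (drop0 (repr (wclass t)) ++ hyp_pairs k))).
  rewrite -!catA; apply: chain_catl; rewrite !catA; apply: chain_catr.
  by apply: chain_catC; [exact: drop0_nonzero | exact: hyp_pairs_nonzero].
apply: ChainTrans (chain_cat sC tC) _.
rewrite -!catA; apply: chain_catl; rewrite !catA; apply: chain_catr.
by apply: chain_catC; [exact: hyp_pairs_nonzero | exact: drop0_nonzero].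
Qed.

Lemma chain_wclass s t : nonzero s -> chain s t -> wclass s = wclass t.
Proof.
move=> s0 st; apply/wclassP; exists [::], [::]; split=> //.
by rewrite !cats0 !drop0_id // (chain_nonzero st).
Qed.

Lemma wclass_drop0 s : wclass (drop0 s) = wclass s.
Proof.
apply/wclassP; exists [::], [::]; split=> //.
rewrite (drop0_id (drop0_nonzero s)); exact: ChainRefl.
Qed.

Lemma wclass_hyp_pairs l : wclass (hyp_pairs l) = wclass [::].
Proof.
have -> : wclass (hyp_pairs l) = wclass (hyp_pairs (drop0 l)).
  rewrite -wclass_drop0; congr wclass; elim: l => //= a l IH.
  by rewrite oppr_eq0; case: eqP => //= _; congr [:: _, _ & _].
apply/wclassP; exists [::], (drop0 l); split; rewrite ?drop0_nonzero //= cats0.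
rewrite drop0_id; first exact: ChainRefl.
exact/hyp_pairs_nonzero/drop0_nonzero.
Qed.

Fact waddA : associative wadd.
Proof.
elim/wittW=> s; elim/wittW=> t; elim/wittW=> u.
by rewrite !wadd_class catA.
Qed.

Fact waddC : commutative wadd.
Proof.
elim/wittW=> s; elim/wittW=> t; rewrite !wadd_class -wclass_drop0 -[RHS]wclass_drop0.
apply: chain_wclass; first exact: drop0_nonzero.
rewrite !drop0_cat; apply: chain_catC; exact: drop0_nonzero.
Qed.

Fact wadd0 : left_id (wclass [::]) wadd.
Proof. by elim/wittW=> s; rewrite wadd_class. Qed.

Fact waddN : left_inverse (wclass [::]) wopp wadd.
Proof.
move=> x; rewrite -[x in wadd _ x]wclass_repr wadd_class -(wclass_hyp_pairs (repr x)).
rewrite -wclass_drop0 -[RHS]wclass_drop0; apply: chain_wclass; first exact: drop0_nonzero.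
apply: chain_perm; last exact: drop0_nonzero.
apply/perm_filter/permP=> p; elim: (repr x) => //= a s IH.
by rewrite !count_cat /= -IH count_cat; ring.
Qed.

HB.instance Definition _ := GRing.isZmodule.Build wittRing waddA waddC wadd0 waddN.

Lemma wclass_cat s t : wclass (s ++ t) = wclass s + wclass t.
Proof. by rewrite -wadd_class. Qed.

Definition wclass1 a := wclass [:: a].

Lemma wclass_cons a s : wclass (a :: s) = wclass1 a + wclass s.
Proof. by rewrite -wclass_cat. Qed.

Lemma wclass_nil : wclass [::] = 0.
Proof. by []. Qed.

Lemma wclass_sum s : wclass s = \sum_(a <- s) wclass1 a.
Proof. by elim: s => [|a s IH]; rewrite ?big_nil // big_cons wclass_cons IH. Qed.

Lemma wclass1_0 : wclass1 0 = 0.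
Proof. by rewrite /wclass1 -wclass_drop0 /= eqxx. Qed.

Lemma wclass1N a : wclass1 (- a) = - wclass1 a.
Proof.
apply/eqP; rewrite -addr_eq0 addrC -wclass_cons.
by rewrite -[[:: a; - a]]/(hyp_pairs [:: a]) wclass_hyp_pairs.
Qed.

Lemma wclass1_square r a : r != 0 -> wclass1 (r ^+ 2 * a) = wclass1 a.
Proof.
move=> r0; have [->|a0] := eqVneq a 0; first by rewrite mulr0.
symmetry; apply: chain_wclass; first by rewrite /= a0.
exact: ChainSquare.
Qed.

Lemma wclass1_binary a b x y (n := x ^+ 2 + a * b * y ^+ 2) :
  a != 0 -> b != 0 -> n != 0 -> wclass1 (n * a) + wclass1 (n * b) = wclass1 a + wclass1 b.
Proof.
move=> a0 b0 n0; rewrite -!wclass_cons; symmetry; apply: chain_wclass.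
  by rewrite /= a0 b0.
exact: ChainBinary.
Qed.

Section Universal.
Variables (V : zmodType) (f : F -> V).
Hypothesis f0 : f 0 = 0.
Hypothesis fN : forall a, f (- a) = - f a.
Hypothesis f_square : forall r a, r != 0 -> a != 0 -> f (r ^+ 2 * a) = f a.
Hypothesis f_binary : forall a b x y, let n := x ^+ 2 + a * b * y ^+ 2 in
  a != 0 -> b != 0 -> n != 0 -> f (n * a) + f (n * b) = f a + f b.

(** Universal property of the additive group of the Witt ring: a function of one
    entry that respects the defining relations extends additively to classes. *)
Lemma sum_chain s t : chain s t -> nonzero s -> \sum_(a <- s) f a = \sum_(a <- t) f a.
Proof.
elim=> {s t} [//|s t u st IH _ IH' s0|r a s r0 /andP[a0 _]|x y a b s n0|a s t _ IH].
- by rewrite IH // IH' // (chain_nonzero st).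
- by rewrite !big_cons f_square.
- by case/and3P=> a0 b0 _; rewrite !big_cons !addrA f_binary.
- by case/andP=> _ s0; rewrite !big_cons IH.
Qed.

Lemma sum_wclass s t : wclass s = wclass t -> \sum_(a <- s) f a = \sum_(a <- t) f a.
Proof.
have drop0E u : \sum_(a <- drop0 u) f a = \sum_(a <- u) f a.
  rewrite big_filter big_mkcond; apply: eq_bigr => a _.
  by case: eqP => // ->.
have hyp_pairsE u : \sum_(a <- hyp_pairs u) f a = 0.
  elim: u => [|a u IH]; rewrite ?big_nil // /hyp_pairs /= !big_cons fN -[flatten _]/(hyp_pairs u).
  by rewrite IH addr0 subrr.
move/wclassP=> [l [l' [l0 l'0 /sum_chain]]]; rewrite nonzero_cat drop0_nonzero hyp_pairs_nonzero //.
by move/(_ isT); rewrite !big_cat /= !hyp_pairsE !drop0E !addr0.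
Qed.
End Universal.

Definition wmul (x y : wittRing) :=
  \sum_(a <- repr x) \sum_(b <- repr y) wclass1 (a * b).

Lemma wmulC : commutative wmul.
Proof.
move=> x y; rewrite /wmul exchange_big /=.
by do 2![apply: eq_bigr => ? _]; rewrite mulrC.
Qed.

(** Multiplication by a fixed entry respects the relations, since
    ab and (ac) (bc) differ by a square. *)
Lemma wmul_welldef s t y : wclass s = wclass t ->
  \sum_(a <- s) \sum_(b <- y) wclass1 (a * b) = \sum_(a <- t) \sum_(b <- y) wclass1 (a * b).
Proof.
apply: sum_wclass => [|a|r a r0 a0|a b x z n a0 b0 n0].
- by rewrite big1 // => b _; rewrite mul0r wclass1_0.
- by rewrite -sumrN; apply: eq_bigr => b _; rewrite mulNr wclass1N.
- by apply: eq_bigr => b _; rewrite -mulrA wclass1_square.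
rewrite -!big_split /=; apply: eq_bigr => c _.
have [->|c0] := eqVneq c 0; first by rewrite !mulr0.
have nE : n = x ^+ 2 + (a * c) * (b * c) * (z / c) ^+ 2 by rewrite /n; field.
by rewrite -!mulrA nE wclass1_binary ?mulf_neq0 // -nE.
Qed.

Lemma wmul_class s t : wmul (wclass s) (wclass t) = \sum_(a <- s) \sum_(b <- t) wclass1 (a * b).
Proof.
rewrite /wmul (wmul_welldef _ (wclass_repr (wclass s))) exchange_big.
rewrite [RHS]exchange_big /= .
under eq_bigr do under eq_bigr do rewrite mulrC.
under [RHS]eq_bigr do under eq_bigr do rewrite mulrC.
exact: (wmul_welldef _ (wclass_repr (wclass t))).
Qed.

Lemma wmul_class1 a b : wmul (wclass1 a) (wclass1 b) = wclass1 (a * b).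
Proof. by rewrite wmul_class !big_seq1. Qed.

Fact wmulDl : left_distributive wmul +%R.
Proof.
elim/wittW=> s; elim/wittW=> t; elim/wittW=> u.
by rewrite -wclass_cat !wmul_class big_cat.
Qed.

Fact wmul0l x : wmul 0 x = 0.
Proof. by rewrite -wclass_nil -[x]wclass_repr wmul_class big_nil. Qed.

Fact wmul1 : left_id (wclass1 1) wmul.
Proof.
elim/wittW=> s; rewrite wmul_class big_seq1 wclass_sum.
by apply: eq_bigr => a _; rewrite mul1r.
Qed.

Lemma wmul_suml (I : Type) (r : seq I) (f : I -> wittRing) w :
  wmul (\sum_(i <- r) f i) w = \sum_(i <- r) wmul (f i) w.
Proof.
by apply: (big_morph (wmul^~ w)) => [? ?|]; rewrite ?wmul0l ?wmulDl.
Qed.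

Lemma wmul_sumr (I : Type) (r : seq I) (f : I -> wittRing) w :
  wmul w (\sum_(i <- r) f i) = \sum_(i <- r) wmul w (f i).
Proof. by rewrite wmulC wmul_suml; apply: eq_bigr => i _; rewrite wmulC. Qed.

Fact wmulA : associative wmul.
Proof.
elim/wittW=> s; elim/wittW=> t; elim/wittW=> u; rewrite (wclass_sum s) (wclass_sum t).
rewrite !wmul_suml; apply: eq_bigr => a _.
rewrite !wmul_sumr wmul_suml; apply: eq_bigr => b _.
rewrite (wclass_sum u) !wmul_sumr; apply: eq_bigr => c _.
by rewrite !wmul_class1 mulrA.
Qed.

HB.instance Definition _ := GRing.Zmodule_isComPzRing.Build wittRing
  wmulA wmulC wmul1 wmulDl.

End Witt.

(** * Pfister forms in the Witt ring *)

Section WittRing.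
Variable F : fieldType.
Implicit Types (a b c r x y : F) (s t u l : seq F).

Lemma wclass1M a b : wclass1 (a * b) = wclass1 a * wclass1 b.
Proof. by rewrite -wmul_class1. Qed.

Lemma wclass1_1 : wclass1 (1 : F) = 1.
Proof. by []. Qed.

Lemma wclass1_sqr r : r != 0 -> wclass1 (r ^+ 2) = 1.
Proof. by move=> r0; rewrite -[r ^+ 2]mulr1 wclass1_square. Qed.

Lemma wclass1V r : wclass1 r^-1 = wclass1 r.
Proof.
have [->|r0] := eqVneq r 0; first by rewrite invr0.
have rV : r^-1 != 0 by rewrite invr_eq0.
by rewrite -(wclass1_square r rV); congr wclass1; field.
Qed.

Lemma wclass1_mulK a : a != 0 -> wclass1 a * wclass1 a = 1.
Proof. by move=> a0; rewrite -wclass1M -expr2 wclass1_sqr. Qed.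

(** The isometry of <a, b> with <a + b, (a + b) ab>; with multiplicativity and
    the triviality of squares it generates all computations below. *)
Lemma wclass1D a b : a != 0 -> b != 0 -> a + b != 0 ->
  wclass1 a + wclass1 b = wclass1 (a + b) * (1 + wclass1 a * wclass1 b).
Proof.
move=> a0 b0 ab0; have := @wclass1_binary _ a b 1 a^-1 a0 b0.
have -> : 1 ^+ 2 + a * b * a^-1 ^+ 2 = (a + b) / a by field.
rewrite mulf_eq0 negb_or ab0 invr_eq0 => /(_ a0) <-.
by rewrite !wclass1M wclass1V -!mulrA wclass1_mulK //; ring.
Qed.

(** The class of the norm form <1, -a, -b, ab> of the quaternion algebra (a, b). *)
Definition pfister2 a b : wittRing F := (1 - wclass1 a) * (1 - wclass1 b).

(** Roundness of the binary form <1, -a>. *)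
Lemma pfister1_norm a x y : a != 0 -> x ^+ 2 - a * y ^+ 2 != 0 ->
  (1 - wclass1 a) * wclass1 (x ^+ 2 - a * y ^+ 2) = 1 - wclass1 a.
Proof.
move=> a0; have [->|x0] := eqVneq x 0.
  rewrite expr0n sub0r oppr_eq0 mulf_eq0 negb_or sqrf_eq0 => /andP[_ y0].
  rewrite wclass1N wclass1M wclass1_sqr // mulr1.
  have := wclass1_mulK a0; set k := wclass1 a => kk.
  by rewrite mulrN mulrBl kk mul1r opprB.
have [->|y0] := eqVneq y 0.
  by rewrite expr0n mulr0 subr0 => _; rewrite wclass1_sqr // mulr1.
move=> n0; have x20 : x ^+ 2 != 0 by rewrite sqrf_eq0.
have ay20 : - (a * y ^+ 2) != 0.
  by rewrite oppr_eq0 mulf_neq0 // sqrf_eq0.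
rewrite mulrC; have := wclass1D x20 ay20 n0.
by rewrite wclass1N wclass1M !wclass1_sqr // !mulr1 mul1r => <-.
Qed.

(** The norm of x1 + x2 X + x3 Y + x4 XY in the quaternion algebra (a, b). *)
Definition qnorm a b (x1 x2 x3 x4 : F) :=
  x1 ^+ 2 - a * x2 ^+ 2 - b * (x3 ^+ 2 - a * x4 ^+ 2).

(** Roundness of <1, -a, -b, ab>. A value is p - b r with p, r values of <1, -a>
    or zero; since <1, -a> absorbs p and r, it identifies <p, -b r> with
    <1, -b>. *)
Lemma pfister2_norm a b x1 x2 x3 x4 : a != 0 -> b != 0 ->
  qnorm a b x1 x2 x3 x4 != 0 ->
  pfister2 a b * wclass1 (qnorm a b x1 x2 x3 x4) = pfister2 a b.
Proof.
rewrite /qnorm /pfister2 => a0 b0.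
have bb := wclass1_mulK b0.
have [p0|p0] := eqVneq (x1 ^+ 2 - a * x2 ^+ 2) 0.
  rewrite p0 sub0r oppr_eq0 mulf_eq0 negb_or => /andP[_ r0].
  have E := pfister1_norm a0 r0.
  rewrite wclass1N wclass1M.
  transitivity ((1 - wclass1 b) * (- wclass1 b) *
    ((1 - wclass1 a) * wclass1 (x3 ^+ 2 - a * x4 ^+ 2))); first by ring.
  by rewrite E mulrN mulrBl bb mul1r opprB mulrC.
have E := pfister1_norm a0 p0.
have [r0|r0] := eqVneq (x3 ^+ 2 - a * x4 ^+ 2) 0.
  by rewrite r0 mulr0 subr0 => _; rewrite mulrAC E.
have E' := pfister1_norm a0 r0; move: p0 r0 E E'.
set p := _ - a * x2 ^+ 2; set r := _ - a * x4 ^+ 2 => p0 r0 Ep Er n0.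
have br0 : - (b * r) != 0 by rewrite oppr_eq0 mulf_neq0.
have := wclass1D p0 br0 n0; rewrite wclass1N wclass1M => E.
set n := wclass1 (p - b * r) in E *.
transitivity (n * ((1 - wclass1 a) - (1 - wclass1 a) * wclass1 b)); first by ring.
rewrite -{2}Er -{2}Ep.
transitivity ((1 - wclass1 a) * (n * (1 + wclass1 p * - (wclass1 b * wclass1 r)))); first by ring.
rewrite -E.
transitivity ((1 - wclass1 a) * wclass1 p - (1 - wclass1 a) * wclass1 r * wclass1 b); first by ring.
by rewrite Ep Er; ring.
Qed.

(** If p = b r with p and r nonzero values of <1, -a>, then <1, -a> absorbs b, so it
    is killed by <1, -b>; if p = r = 0, then a is a square. *)
Lemma pfister2_isotropic a b x1 x2 x3 x4 : a != 0 -> b != 0 ->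
  qnorm a b x1 x2 x3 x4 = 0 ->
  [|| x1 != 0, x2 != 0, x3 != 0 | x4 != 0] -> pfister2 a b = 0.
Proof.
rewrite /qnorm /pfister2 => a0 b0 n0 nz.
have sq x y : (x != 0) || (y != 0) -> x ^+ 2 - a * y ^+ 2 = 0 -> wclass1 a = 1.
  move=> xy /eqP; rewrite subr_eq0 => /eqP E.
  have y0 : y != 0.
    apply: contraTneq xy => y0; rewrite y0 eqxx orbF negbK.
    by rewrite -sqrf_eq0 E y0 expr0n mulr0.
  have x0 : x != 0 by rewrite -sqrf_eq0 E mulf_neq0 // sqrf_eq0.
  have -> : a = (x / y) ^+ 2 by rewrite expr_div_n E mulfK // sqrf_eq0.
  by rewrite wclass1_sqr // mulf_neq0 // invr_eq0.
have [r0|r0] := eqVneq (x3 ^+ 2 - a * x4 ^+ 2) 0.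
  have p0 : x1 ^+ 2 - a * x2 ^+ 2 = 0.
    by rewrite -n0 r0 mulr0 subr0.
  suff -> : wclass1 a = 1 by rewrite subrr mul0r.
  move: nz; rewrite orbA => /orP[xy|xy]; [exact: sq xy p0 | exact: sq xy r0].
have E := pfister1_norm a0 r0.
have pE : x1 ^+ 2 - a * x2 ^+ 2 = b * (x3 ^+ 2 - a * x4 ^+ 2).
  by apply/eqP; rewrite -subr_eq0 n0.
have p0 : x1 ^+ 2 - a * x2 ^+ 2 != 0 by rewrite pE mulf_neq0.
have := pfister1_norm a0 p0; rewrite pE wclass1M mulrCA E => E'.
by rewrite mulrBr mulr1 mulrC E' subrr.
Qed.

(** The vanishing of all threefold Pfister forms, which generate the third power of
    the fundamental ideal. *)
Definition pfister3_zero :=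
  forall a b c, a != 0 -> b != 0 -> c != 0 -> pfister2 a b * (1 - wclass1 c) = 0.

Hypothesis char2 : 2%:R != 0 :> F.

Fixpoint hyp_planes n : seq F := if n is n'.+1 then 1 :: -1 :: hyp_planes n' else [::].

Lemma size_hyp_planes n : size (hyp_planes n) = n.*2.
Proof. by elim: n => //= n ->. Qed.

Lemma nonzero_hyp_planes n : nonzero (hyp_planes n).
Proof. by elim: n => //= n ->; rewrite oppr_eq0 oner_eq0. Qed.

Lemma hyp_planesD m n : hyp_planes (m + n) = hyp_planes m ++ hyp_planes n.
Proof. by elim: m => //= m ->. Qed.

Lemma hyp_pairs_chain l : nonzero l -> chain (hyp_pairs l) (hyp_planes (size l)).
Proof.
elim: l => [|a l IH] /=; first by move=> _; exact: ChainRefl.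
case/andP=> a0 /IH H; apply: (ChainTrans (chain_hyp char2 _ a0)).
exact/ChainCons/ChainCons.
Qed.

Lemma wclass_chain_hyp s t : nonzero s -> nonzero t -> wclass s = wclass t ->
  exists h k, chain (hyp_planes h ++ s) (hyp_planes k ++ t).
Proof.
move=> s0 t0 /wclassP[l [l' [l0 l'0]]]; rewrite !drop0_id // => st.
exists (size l), (size l').
apply: ChainTrans (chain_catC (nonzero_hyp_planes _) s0) _.
apply: ChainTrans (chain_catl _ (chain_sym (hyp_pairs_chain l0))) _.
apply: ChainTrans st _; apply: ChainTrans (chain_catl _ (hyp_pairs_chain l'0)) _.
exact: chain_catC (nonzero_hyp_planes _).
Qed.

(** Equality in the Witt ring and equal dimension give isometry: count the
    hyperbolic planes and cancel them. *)
Lemma wclass_chain s t :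
  nonzero s -> nonzero t -> size s = size t -> wclass s = wclass t -> chain s t.
Proof.
move=> s0 t0 st /(wclass_chain_hyp s0 t0)[h [k hk]].
have := chain_size hk; rewrite !size_cat !size_hyp_planes st => /addIn/double_inj E.
rewrite E in hk; exact: (chain_cancel_cat char2 (nonzero_hyp_planes k) s0 hk).
Qed.

Lemma wclass0_split s : nonzero s -> s != [::] -> wclass s = 0 ->
  exists s', chain s (1 :: -1 :: s').
Proof.
move=> s0 sN s_0.
have [h [k hk]] := @wclass_chain_hyp s [::] s0 isT s_0.
have := chain_size hk; rewrite !size_cat !size_hyp_planes addn0 => sz.
have hlk : (h < k)%N.
  by rewrite -ltn_double -sz -addn1 leq_add2l lt0n size_eq0.
rewrite cats0 -(subnKC hlk) addSnnS hyp_planesD in hk.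
exists (hyp_planes (k - h.+1)).
exact: (chain_cancel_cat char2 (nonzero_hyp_planes h) s0 hk).
Qed.

(** The forms <<a, b>> and c <<a, b>> have the same class, hence are isometric; the
    second one represents c. *)
Lemma qnorm_universal a b c : pfister3_zero -> a != 0 -> b != 0 -> c != 0 ->
  exists x1 x2 x3 x4, qnorm a b x1 x2 x3 x4 = c.
Proof.
move=> J a0 b0 c0.
pose s := [:: 1; - a; - b; a * b]; pose t := [:: c; - (a * c); - (b * c); a * b * c].
have s0 : nonzero s by rewrite /= !(oppr_eq0, mulf_eq0) oner_eq0 !negb_or a0 b0.
have t0 : nonzero t by rewrite /= !(oppr_eq0, mulf_eq0) !negb_or a0 b0 c0.
have st : wclass s = wclass t.
  apply/eqP; rewrite -subr_eq0 -(J a b c) // !wclass_cons !wclass1N !wclass1M wclass_nil.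
  by rewrite wclass1_1 /pfister2; apply/eqP; ring.
have [T hT] := chain_represents (wclass_chain s0 t0 erefl st).
pose e := consv 1 (fun=> 0 : F); exists (T e 0%N), (T e 1%N), (T e 2%N), (T e 3%N).
transitivity (bil t e e); last by rewrite /= /shift /=; ring.
by rewrite -hT /= /shift /qnorm /=; ring.
Qed.

End WittRing.

(** * Presentations and diagonal forms of odd dimension *)

Section Steps.
Variable F : fieldType.
Implicit Types (a b c d r x y : F) (l : seq F) (s t u : seq (F * F)).

Definition nzsym s := all (fun p => (p.1 != 0) && (p.2 != 0)) s.

(** Steps between lists of symbols, which unlike presentations of fixed length can
    be recursed on. *)
Definition sconn : seq (F * F) -> seq (F * F) -> Prop :=
  clos_refl_trans _ (fun s t => elem_step s t /\ nzsym t).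

Lemma sconn_refl s : sconn s s. Proof. exact: rt_refl. Qed.
Lemma sconn_trans t s u : sconn s t -> sconn t u -> sconn s u.
Proof. exact: rt_trans. Qed.

Lemma sconn_nzsym s t : sconn s t -> nzsym s -> nzsym t.
Proof. by elim=> {s t} [s t [] //|//|s t u _ IH _ IH' /IH]. Qed.

Lemma elem_step_cons p s t : elem_step s t -> elem_step (p :: s) (p :: t).
Proof.
case=> [s1 s2 c d c' d' b|s1 s2 c d a b|s1 s2 c d a b].
- exact: (ElemStep1 (p :: s1)).
- exact: (ElemStep2 (p :: s1)).
- exact: (ElemStep3 (p :: s1)).
Qed.

Lemma sconn_cons p s t : p.1 != 0 -> p.2 != 0 -> sconn s t ->
  sconn (p :: s) (p :: t).
Proof.
move=> p1 p2; elim=> {s t} [s t [st t0]|s|s t u _ IH _ IH'].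
- by apply: rt_step; split; [exact: elem_step_cons | rewrite /= p1 p2].
- exact: sconn_refl.
- exact: sconn_trans IH IH'.
Qed.

Lemma sconn_step2 c d x y s (n := x ^+ 2 - y ^+ 2 * d) :
  n != 0 -> nzsym ((c, d) :: s) -> sconn ((c, d) :: s) ((n * c, d) :: s).
Proof.
move=> n0 /= /andP[/andP[/= c0 d0] s0]; apply: rt_step; split.
  exact: (ElemStep2 [::]).
by rewrite /= mulf_neq0 // d0.
Qed.

Lemma sconn_step3 c d x y s (n := x ^+ 2 - y ^+ 2 * c) :
  n != 0 -> nzsym ((c, d) :: s) -> sconn ((c, d) :: s) ((c, n * d) :: s).
Proof.
move=> n0 /= /andP[/andP[/= c0 d0] s0]; apply: rt_step; split.
  exact: (ElemStep3 [::]).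
by rewrite /= c0 mulf_neq0.
Qed.

Lemma sconn_square c d x y s : x != 0 -> y != 0 -> nzsym ((c, d) :: s) ->
  sconn ((c, d) :: s) ((x ^+ 2 * c, y ^+ 2 * d) :: s).
Proof.
move=> x0 y0 nz.
have := @sconn_step2 c d x 0 s; have := @sconn_step3 (x ^+ 2 * c) d y 0 s.
rewrite !expr0n /= !mul0r !subr0 !sqrf_eq0 => H3 /(_ x0 nz) H2.
exact: sconn_trans H2 (H3 y0 (sconn_nzsym H2 nz)).
Qed.

(** In [ElemStep1] y is 1; a general y reduces to it by dividing by the square of y. *)
Lemma sconn_step1 c d c' d' x y s (n := x ^+ 2 - c * c' * y ^+ 2) :
  n != 0 -> nzsym ((c, d) :: (c', d') :: s) ->
  sconn ((c, d) :: (c', d') :: s) ((c, n * d) :: (c', n * d') :: s).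
Proof.
move=> n0 nz; case/and3P: (nz) => /andP[/= c0 d0] /andP[/= c'0 d'0] s0.
have [y0|y0] := eqVneq y 0.
  have nE : n = x ^+ 2 by rewrite /n y0 expr0n mulr0 subr0.
  have x0 : x != 0 by rewrite -sqrf_eq0 -nE.
  have H1 := @sconn_square c d 1 x _ (oner_neq0 _) x0 nz.
  have H2 := @sconn_square c' d' 1 x s (oner_neq0 _) x0.
  rewrite nE !expr1n !mul1r in H1 H2 *; apply: sconn_trans H1 _.
  apply: sconn_cons => //=; first by rewrite mulf_neq0 // sqrf_eq0.
  by apply: H2; rewrite /= c'0 d'0.
pose m := (x / y) ^+ 2 - c * c'.
have nE : n = y ^+ 2 * m by rewrite /n /m; field.
have m0 : m != 0 by move: n0; rewrite nE mulf_eq0 negb_or => /andP[].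
have H : sconn ((c, d) :: (c', d') :: s) ((c, m * d) :: (c', m * d') :: s).
  apply: rt_step; split; first exact: (ElemStep1 [::]).
  by rewrite /= c0 c'0 !mulf_neq0.
apply: sconn_trans (H) _; have {}H := sconn_nzsym H nz.
have H1 := @sconn_square c (m * d) 1 y _ (oner_neq0 _) y0 H.
have H2 := @sconn_square c' (m * d') 1 y s (oner_neq0 _) y0.
rewrite nE -2!(mulrA (y ^+ 2)); rewrite !expr1n !mul1r in H1 H2; apply: sconn_trans H1 _.
apply: sconn_cons => //=; first by rewrite !mulf_neq0 // sqrf_eq0.
by apply: H2; rewrite /= c'0 mulf_neq0.
Qed.

(** (c, d) is first replaced by (c, -cd); the first slot is then multiplied by the
    value n of <1, cd>, and the replacement is undone. *)
Lemma sconn_both c d x y s (n := x ^+ 2 + c * d * y ^+ 2) :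
  n != 0 -> nzsym ((c, d) :: s) -> sconn ((c, d) :: s) ((n * c, n * d) :: s).
Proof.
move=> n0 nz; case/andP: (nz) => /andP[/= c0 d0] s0.
have H1 : sconn ((c, d) :: s) ((c, (0 ^+ 2 - 1 ^+ 2 * c) * d) :: s).
  by apply: sconn_step3 => //; rewrite expr0n expr1n mul1r sub0r oppr_eq0.
apply: sconn_trans (H1) _; have {}nz := sconn_nzsym H1 nz; move: nz {H1}.
rewrite expr0n expr1n mul1r sub0r mulNr => nz.
have nE : n = x ^+ 2 - y ^+ 2 * - (c * d) by rewrite /n; ring.
have H2 := @sconn_step2 c (- (c * d)) x y s; rewrite -nE in H2; move: (H2 n0 nz) => {}H2.
apply: sconn_trans (H2) _; have {}nz := sconn_nzsym H2 nz.
have H3 := @sconn_step3 (n * c) (- (c * d)) 0 1 s.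
have E : 0 ^+ 2 - 1 ^+ 2 * (n * c) = - (n * c) by ring.
have nc0 : - (n * c) != 0 by rewrite oppr_eq0 mulf_neq0.
rewrite E in H3; move: (H3 nc0 nz) => {}H3.
apply: sconn_trans (H3) _; have {}nz := sconn_nzsym H3 nz.
have cV : c^-1 != 0 by rewrite invr_eq0.
have := sconn_square (oner_neq0 _) cV nz.
by congr (sconn _ ((_, _) :: s)); field.
Qed.

(** The remaining entries are headed by -bxy because, in the Witt ring, <b, x, y> is
    the sum of b <<-bx, -by>> and <-bxy>. *)
Fixpoint pres b l : seq (F * F) :=
  if l is x :: y :: l' then (- (b * x), - (b * y)) :: pres (- (b * x * y)) l'
  else [::].

Definition pres_of l := if l is b :: l' then pres b l' else [::].

Lemma seq2_ind (T : Type) (P : seq T -> Prop) :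
  P [::] -> (forall z, P [:: z]) -> (forall z w (l : seq T), P l -> P (z :: w :: l)) ->
  forall l : seq T, P l.
Proof.
move=> P0 P1 P2 l; suff [] : P l /\ forall z, P (z :: l) by [].
by elim: l => [|w l [Pl Pl']]; split=> // z; exact: P2.
Qed.

Lemma nzsym_pres b l : b != 0 -> nonzero l -> nzsym (pres b l).
Proof.
elim/seq2_ind: l b => //= x y l IH b b0 /and3P[x0 y0 l0].
by rewrite !oppr_eq0 !mulf_neq0 //= IH // oppr_eq0 !mulf_neq0.
Qed.

(** Scaling the head by a square scales every slot by a square. *)
Lemma pres_square r b l : r != 0 -> b != 0 -> nonzero l ->
  sconn (pres b l) (pres (r ^+ 2 * b) l).
Proof.
move=> r0; elim/seq2_ind: l b => /= [|z|x y l IH] b b0; try by move=> *; exact: sconn_refl.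
case/and3P=> x0 y0 l0.
have nz : nzsym (pres b [:: x, y & l]) by rewrite nzsym_pres //= x0 y0.
have H := sconn_square r0 r0 nz; apply: sconn_trans (H) _.
have -> : r ^+ 2 * - (b * x) = - (r ^+ 2 * b * x) by ring.
have -> : r ^+ 2 * - (b * y) = - (r ^+ 2 * b * y) by ring.
have -> : - (r ^+ 2 * b * x * y) = r ^+ 2 * - (b * x * y) by ring.
have r2 : r ^+ 2 != 0 by rewrite sqrf_eq0.
apply: sconn_cons => /=; rewrite ?oppr_eq0 ?mulf_neq0 //.
by apply: IH; rewrite ?oppr_eq0 ?mulf_neq0.
Qed.

(** A chain move may act at any depth, and the position of an entry modulo 2 decides
    its role in the presentation. The induction therefore treats lists of odd and
    even length together, with one or two extra entries in front: the conclusions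
    with extra entries are the ones that survive prepending an entry. *)
Lemma chain_sconn l l' : chain l l' -> nonzero l ->
  if odd (size l) then sconn (pres_of l) (pres_of l') /\
      (forall b a, b != 0 -> a != 0 -> sconn (pres b (a :: l)) (pres b (a :: l')))
  else forall b, b != 0 -> sconn (pres b l) (pres b l').
Proof.
elim=> {l l'} [l|l l' l'' ll' IH _ IH'|r a l r0|x y a a' l n0|a l l' ll' IH] nz.
- by case: ifP => _; [split|]=> *; exact: sconn_refl.
- move: (IH nz) (IH' (chain_nonzero ll' nz)); rewrite -(chain_size ll').
  case: ifP => _ => [[H1 H2] [H1' H2']|H H' b b0].
    split=> [|b a b0 a0]; first exact: sconn_trans H1 H1'.
    exact: sconn_trans (H2 _ _ b0 a0) (H2' _ _ b0 a0).
  exact: sconn_trans (H _ b0) (H' _ b0).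
- have r2 : r ^+ 2 != 0 by rewrite sqrf_eq0.
  case/andP: (nz) => a0 l0; case: ifP => /= oddl.
    split=> [|b b' b0 b'0]; first exact: pres_square.
    have nz' : nzsym (pres b [:: b', a & l]) by rewrite nzsym_pres //= b'0 a0.
    have := sconn_square (oner_neq0 _) r0 nz'; rewrite expr1n mul1r => H.
    apply: sconn_trans (H) _.
    have -> : r ^+ 2 * - (b * a) = - (b * (r ^+ 2 * a)) by ring.
    have -> : - (b * b' * (r ^+ 2 * a)) = r ^+ 2 * - (b * b' * a) by ring.
    apply: sconn_cons => /=; rewrite ?oppr_eq0 ?mulf_neq0 //.
    by apply: pres_square; rewrite ?oppr_eq0 ?mulf_neq0.
  move=> b b0; case: l l0 nz oddl => [//|z l] /andP[z0 l0] nz _.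
  have nz' : nzsym (pres b [:: a, z & l]) by rewrite nzsym_pres //= z0 a0.
  have := sconn_square r0 (oner_neq0 _) nz'; rewrite expr1n mul1r => H.
  apply: sconn_trans (H) _.
  have -> : r ^+ 2 * - (b * a) = - (b * (r ^+ 2 * a)) by ring.
  have -> : - (b * (r ^+ 2 * a) * z) = r ^+ 2 * - (b * a * z) by ring.
  apply: sconn_cons => /=; rewrite ?oppr_eq0 ?mulf_neq0 //.
  by apply: pres_square; rewrite ?oppr_eq0 ?mulf_neq0.
- move: n0; set n := _ + _ => n0; case/and3P: (nz) => a0 a'0 l0; case: ifP => /= oddl.
    case: l l0 nz oddl => [//|z l] /andP[z0 l0] nz oddl; split=> [|b b' b0 b'0].
      have nz' : nzsym (pres a [:: a', z & l]) by rewrite nzsym_pres //= a'0 z0.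
      have nE : n = x ^+ 2 - y ^+ 2 * - (a * a') by rewrite /n; ring.
      have := @sconn_step3 (- (a * a')) (- (a * z)) x y _ _ nz'; rewrite -nE => /(_ n0) H.
      apply: sconn_trans (H) _; have {}nz' := sconn_nzsym H nz'.
      have {}H := sconn_square n0 (oner_neq0 _) nz'.
      apply: sconn_trans (H) _.
      have -> : n ^+ 2 * - (a * a') = - (n * a * (n * a')) by ring.
      have -> : 1 ^+ 2 * (n * - (a * z)) = - (n * a * z) by ring.
      have -> : - (n * a * (n * a') * z) = n ^+ 2 * - (a * a' * z) by ring.
      apply: sconn_cons => /=; rewrite ?oppr_eq0 ?mulf_neq0 //.
      by apply: pres_square; rewrite ?oppr_eq0 ?mulf_neq0.
    have nz' : nzsym (pres b [:: b', a, a', z & l]).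
      by rewrite nzsym_pres //= b'0 a0 a'0 z0.
    (* The move straddles two factors; it is ElemStep1, as the product of the two
       first slots is - a a' up to a square. *)
    set c := - (b * b'); set c' := - (- (b * b' * a) * a').
    have nE : n = x ^+ 2 - c * c' * (y / (b * b')) ^+ 2.
      by rewrite /n /c /c'; field; rewrite b0 b'0.
    have := @sconn_step1 c (- (b * a)) c' (- (- (b * b' * a) * z)) x (y / (b * b')) _ _ nz'.
    rewrite -nE => /(_ n0) H.
    apply: sconn_trans (H) _; have {}nz' := sconn_nzsym H nz'.
    have -> : n * - (b * a) = - (b * (n * a)) by ring.
    apply: sconn_cons => /=; rewrite ?oppr_eq0 ?mulf_neq0 //.
    have {}nz' : nzsym ((c', n * - (- (b * b' * a) * z)) ::
       pres (- (- (b * b' * a) * a' * z)) l) by case/andP: nz'.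
    have {}H := sconn_square n0 (oner_neq0 _) nz'.
    apply: sconn_trans (H) _.
    have -> : n ^+ 2 * c' = - (- (b * b' * (n * a)) * (n * a')) by rewrite /c'; ring.
    have -> : 1 ^+ 2 * (n * - (- (b * b' * a) * z)) = - (- (b * b' * (n * a)) * z).
      by ring.
    have -> : - (- (b * b' * (n * a)) * (n * a') * z) =
       n ^+ 2 * - (- (b * b' * a) * a' * z) by ring.
    apply: sconn_cons => /=; rewrite ?oppr_eq0 ?mulf_neq0 ?oppr_eq0 ?mulf_neq0 //.
    by apply: pres_square; rewrite ?oppr_eq0 ?mulf_neq0 ?oppr_eq0 ?mulf_neq0.
  move=> b b0.
  have nz' : nzsym (pres b [:: a, a' & l]) by rewrite nzsym_pres //= a0 a'0.
  have nE : n = x ^+ 2 + - (b * a) * - (b * a') * (y / b) ^+ 2 by rewrite /n; field.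
  have := @sconn_both (- (b * a)) (- (b * a')) x (y / b) _ _ nz'; rewrite -nE => /(_ n0) H.
  apply: sconn_trans (H) _.
  have -> : n * - (b * a) = - (b * (n * a)) by ring.
  have -> : n * - (b * a') = - (b * (n * a')) by ring.
  have -> : - (b * (n * a) * (n * a')) = n ^+ 2 * - (b * a * a') by ring.
  apply: sconn_cons => /=; rewrite ?oppr_eq0 ?mulf_neq0 //.
  by apply: pres_square; rewrite ?oppr_eq0 ?mulf_neq0.
- case/andP: nz => a0 l0; move: (IH l0) => /=; case: ifP => //= oddl; last first.
    move=> H; split=> [|b b' b0 b'0]; first exact: H.
    apply: sconn_cons => /=; rewrite ?oppr_eq0 ?mulf_neq0 //.
    by apply: H; rewrite oppr_eq0 !mulf_neq0.
  by case=> _ H b b0; exact: H.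
Qed.

(** The entries after b of the form with head b and presentation s: these invert
    pres. *)
Fixpoint slot_tail b s : seq F :=
  if s is (c, d) :: s' then - c / b :: - d / b :: slot_tail (- (c * d) / b) s' else [::].
(** The head is chosen so that the last entry of the sequence b, -bxy, ... is 1. *)
Definition slot_head s : F := foldr (fun p b => - (p.1 * p.2) / b) 1 s.
Definition slot_form s := slot_head s :: slot_tail (slot_head s) s.

Lemma slot_tailK b s : b != 0 -> nzsym s -> pres b (slot_tail b s) = s.
Proof.
elim: s b => //= -[c d] s IH b b0 /= /andP[/andP[/= c0 d0] s0].
congr ((_, _) :: _); [by field | by field |].
have -> : - (b * (- c / b) * (- d / b)) = - (c * d) / b by field.
by apply: IH => //; rewrite mulf_neq0 ?invr_eq0 // oppr_eq0 mulf_neq0.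
Qed.

Lemma slot_tail_nonzero b s : b != 0 -> nzsym s -> nonzero (slot_tail b s).
Proof.
elim: s b => //= -[c d] s IH b b0 /= /andP[/andP[/= c0 d0] s0].
have H z : z != 0 -> - z / b != 0 by move=> ?; rewrite mulf_neq0 ?invr_eq0 ?oppr_eq0.
by rewrite !H //= IH // H // mulf_neq0.
Qed.

Lemma slot_head_neq0 s : nzsym s -> slot_head s != 0.
Proof.
elim: s => [|[c d] s IH] /=; first by rewrite oner_neq0.
by case/andP=> /andP[/= c0 d0] /IH h0; rewrite mulf_neq0 ?invr_eq0 ?oppr_eq0 ?mulf_neq0.
Qed.

Lemma size_slot_tail b s : size (slot_tail b s) = (size s).*2.
Proof. by elim: s b => //= -[c d] s IH b /=; rewrite IH. Qed.

Definition symbol_sum s := \sum_(p <- s) pfister2 p.1 p.2.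

(** Each factor contributes a multiple b <<c, d>>, and the vanishing of threefold
    Pfister forms removes the scalar b. *)
Lemma wclass_slot_form s : pfister3_zero F -> nzsym s ->
  wclass (slot_form s) = symbol_sum s + 1.
Proof.
move=> J; elim: s => [|[c d] s IH]; first by rewrite /symbol_sum big_nil add0r.
case/andP=> /andP[/= c0 d0] s0; rewrite /symbol_sum big_cons /= -addrA.
rewrite -/(symbol_sum s) -(IH s0) /slot_form /=.
set h := slot_head s; have h0 : h != 0 := slot_head_neq0 s0.
set b := _ / h; have b0 : b != 0.
  by rewrite mulf_neq0 ?invr_eq0 ?oppr_eq0 ?mulf_neq0.
have E : - (c * d) / b = h .
  by rewrite /b; field; rewrite h0 oppr_eq0 mulf_neq0.
clearbody b; have kh : wclass1 h = - (wclass1 c * wclass1 d * wclass1 b).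
  by rewrite -E mulNr wclass1N !wclass1M wclass1V.
rewrite E !wclass_cons kh.
rewrite !mulNr !wclass1N !wclass1M !wclass1V.
have := J c d b c0 d0 b0; rewrite mulrBr mulr1 => /eqP; rewrite subr_eq0 => /eqP E'.
by rewrite E' /pfister2; ring.
Qed.

Hypothesis char2 : 2%:R != 0 :> F.

Lemma symbol_sum_sconn s t : pfister3_zero F -> nzsym s -> nzsym t ->
  size s = size t -> symbol_sum s = symbol_sum t -> sconn s t.
Proof.
move=> J s0 t0 sz st.
have nz u : nzsym u -> nonzero (slot_form u).
  by move=> u0; rewrite /= slot_head_neq0 //= slot_tail_nonzero // slot_head_neq0.
have K u : nzsym u -> pres_of (slot_form u) = u.
  by move=> u0; rewrite /= slot_tailK // slot_head_neq0.
have ch : chain (slot_form s) (slot_form t).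
  apply: wclass_chain => //; try exact: nz; first by rewrite /= !size_slot_tail sz.
  by rewrite !wclass_slot_form // st.
have := chain_sconn ch (nz _ s0).
have -> : odd (size (slot_form s)) by rewrite /= size_slot_tail odd_double.
by rewrite !K // => -[].
Qed.

Lemma sconn_connected n (p q : presentation F n) : sconn p q -> connected p q.
Proof.
move=> pq.
suff H s t : sconn s t -> forall p : presentation F n, s = p ->
    exists q : presentation F n, t = q /\ connected p q.
  have [q' [qE pq']] := H _ _ pq p erefl.
  suff -> : q = q' by [].
  case: (q) (q') qE => [sl nsl] [sl' nsl'] /= E.
  have {}E : sl = sl' by apply: val_inj.
  by subst sl'; congr Presentation; exact: eq_irrelevance.
elim=> {s t p q pq} [s t [st t0] p sE|s p sE|s t u _ IH _ IH' p sE].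
- have szt : size t == n.
    rewrite -(size_tuple p) -sE; case: st => *; by rewrite !size_cat.
  exists (@Presentation F n (Tuple szt) t0); split=> //.
  by apply: rt_step; rewrite /step -sE.
- by exists p; split=> //; exact: rt_refl.
have [q [tE pq]] := IH p sE; have [v [uE qv]] := IH' q tE.
by exists v; split=> //; exact: rt_trans qv.
Qed.

End Steps.

(** * Discriminants *)

Section Discriminant.
Variable F : fieldType.
Implicit Types (a b c r x y : F) (t l : seq F).

Lemma chain_prod (s t : seq F) : chain s t ->
  exists2 r, r != 0 & \prod_(a <- t) a = r ^+ 2 * \prod_(a <- s) a.
Proof.
elim=> {s t} [s|s t u _ [r r0 ->] _ [r' r'0 ->]|r a s r0|x y a b s n0|a s t _ [r r0 E]].
- by exists 1; rewrite ?oner_neq0 // expr1n mul1r.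
- by exists (r' * r); [rewrite mulf_neq0 | ring].
- by exists r; rewrite // !big_cons mulrA.
- by eexists; [exact: n0 | rewrite !big_cons; ring].
- by exists r; rewrite // !big_cons E mulrCA.
Qed.

Lemma prod_hyp_planes n : \prod_(a <- hyp_planes F n) a = (-1) ^+ n.
Proof. by elim: n => [|n IH]; rewrite ?big_nil // !big_cons IH exprS mul1r. Qed.

Definition symbol_form (s : seq (F * F)) : seq F :=
  flatten [seq [:: 1; - p.1; - p.2; p.1 * p.2] | p <- s].

Lemma wclass_symbol_form (s : seq (F * F)) : wclass (symbol_form s) = symbol_sum s.
Proof.
rewrite /symbol_sum; elim: s => [|p s IH]; first by rewrite big_nil wclass_nil.
rewrite big_cons -IH /symbol_form /= !wclass_cons !wclass1N wclass1M wclass1_1.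
by rewrite -/(symbol_form s) /pfister2; ring.
Qed.

Lemma symbol_form_nonzero s : nzsym s -> nonzero (symbol_form s).
Proof.
elim: s => //= p s IH /andP[/andP[p1 p2] /IH s0].
by rewrite oner_neq0 !oppr_eq0 p1 p2 mulf_neq0.
Qed.

Lemma prod_symbol_form s : nzsym s ->
  exists2 r, r != 0 & \prod_(a <- symbol_form s) a = r ^+ 2.
Proof.
elim: s => [_|p s IH /= /andP[/andP[p1 p2] /IH[r r0 E]]].
  by exists 1; rewrite ?oner_neq0 // big_nil expr1n.
exists (p.1 * p.2 * r); first by rewrite !mulf_neq0.
by rewrite !big_cons -/(symbol_form s) E; ring.
Qed.

Lemma size_symbol_form s : size (symbol_form s) = (size s).*2.*2.
Proof. by elim: s => //= p s ->. Qed.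

Hypothesis char2 : 2%:R != 0 :> F.

(** The form of symbol_sum s has dimension divisible by 4 and square determinant.
    Comparing it with <1, -c> t, of dimension 2 n and determinant (-c)^n up to
    squares, would make c a square if n were odd. *)
Lemma symbol_sum_even (s : seq (F * F)) c t :
  nzsym s -> c != 0 -> (forall r, r ^+ 2 != c) -> nonzero t ->
  symbol_sum s = (1 - wclass1 c) * wclass t -> ~~ odd (size t).
Proof.
move=> s0 c0 cN t0 E; apply/negP => oddt.
pose t' := t ++ map (fun x => - c * x) t.
have tt : forall u : seq F, nonzero u -> nonzero (map (fun x => - c * x) u).
  by elim=> //= a u IH /andP[a0 /IH ->]; rewrite mulf_neq0 // oppr_eq0.
have t'0 : nonzero t' by rewrite nonzero_cat t0 tt.
have clt u : wclass (map (fun x => - c * x) u) = - (wclass1 c * wclass u).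
  elim: u => [|a u IH] /=; first by rewrite wclass_nil mulr0 oppr0.
  by rewrite !wclass_cons IH mulNr wclass1N wclass1M; ring.
have st : wclass (symbol_form s) = wclass t'.
  by rewrite wclass_symbol_form E /t' wclass_cat clt; ring.
have [h [k hk]] := wclass_chain_hyp char2 (symbol_form_nonzero s0) t'0 st.
have := chain_size hk.
rewrite /t' !size_cat !size_hyp_planes size_symbol_form size_map => sz.
have [r r0] := chain_prod hk; rewrite !big_cat /= !prod_hyp_planes.
have [P P0 ->] := prod_symbol_form s0.
have prodm u : \prod_(a <- map (fun x => - c * x) u) a
   = (- c) ^+ (size u) * \prod_(a <- u) a.
  elim: u => [|a u IH]; first by rewrite !big_nil mulr1.
  by rewrite /= !big_cons IH exprS; ring.
rewrite prodm; set T := \prod_(a <- t) a.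
have T0 : T != 0.
  rewrite /T; elim: (t) t0 => [|a u IH]; first by rewrite big_nil oner_neq0.
  by rewrite big_cons => /= /andP[a0 /IH u0]; rewrite mulf_neq0.
move: sz oddt; set n := size t => sz oddn.
have hE : (-1) ^+ h = - (-1) ^+ k :> F.
  rewrite -signr_odd -[in RHS]signr_odd; have -> : odd h = ~~ odd k by lia.
  by case: (odd k); rewrite ?opprK ?expr0 ?expr1.
have nE : (- c) ^+ n = - c * (c ^+ n./2) ^+ 2.
  rewrite -{1}(odd_double_half n) oddn add1n exprS.
  by rewrite -mul2n exprM sqrrN -exprM mulnC exprM.
rewrite hE nE => H.
have sg : (-1) ^+ k != 0 :> F by rewrite signr_eq0.
have q0 : c ^+ n./2 != 0 by rewrite expf_neq0.
have := cN (r * P / (c ^+ n./2 * T)); move/eqP; apply.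
have H2 : c * (c ^+ n./2 * T) ^+ 2 = (r * P) ^+ 2.
  apply: (mulfI sg); apply: oppr_inj.
  transitivity ((-1) ^+ k * (T * (- c * c ^+ n./2 ^+ 2 * T))); first by ring.
  by rewrite H; ring.
by rewrite expr_div_n -H2 mulfK // sqrf_eq0 mulf_neq0.
Qed.

(** <1, -c> <a, b> is a multiple of <<c, -ab>>, and symbols with the common slot c
    add up by multiplying the other slot. *)
Lemma pfister_common_slot c t : pfister3_zero F -> c != 0 -> nonzero t ->
  ~~ odd (size t) -> exists2 x, x != 0 & (1 - wclass1 c) * wclass t = pfister2 c x.
Proof.
move=> J c0; elim/seq2_ind: t => [_ _|//|a b t IH /= /and3P[a0 b0 t0]].
  by exists 1; rewrite ?oner_neq0 // wclass_nil /pfister2 wclass1_1; ring.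
rewrite negbK => /(IH t0)[x x0 E]; exists (- (a * b) * x).
  by rewrite mulf_neq0 // oppr_eq0 mulf_neq0.
rewrite !wclass_cons !mulrDr E.
have ab0 : - (a * b) != 0 by rewrite oppr_eq0 mulf_neq0.
have J1 := J _ _ _ c0 ab0 x0; have J2 := J _ _ _ c0 ab0 a0.
have aa := wclass1_mulK a0; move: J1 J2; rewrite /pfister2 mulNr !wclass1N !wclass1M.
set A := wclass1 a in aa *; set B := wclass1 b; set C := wclass1 c; set X := wclass1 x => J1 J2.
have E1 : (1 - C) * A + (1 - C) * B = (1 - C) * (1 + A * B) * A.
  transitivity ((1 - C) * (A + (A * A) * B)); first by rewrite aa; ring.
  by ring.
rewrite addrA E1.
have -> : (1 - C) * (1 + A * B) * A = (1 - C) * (1 + A * B).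
  apply/eqP; rewrite eq_sym -subr_eq0; apply/eqP; rewrite -[RHS]J2; ring.
apply/eqP; rewrite -subr_eq0; apply/eqP; rewrite -[RHS]J1; ring.
Qed.

End Discriminant.

(** * Quadratic extensions *)

Section QuadraticExtension.
Variables (F K : fieldType) (iota : {rmorphism F -> K}) (c : F) (z : K).
(** K is F(z) with z a square root of the nonsquare c; re and im are the
    coordinates in the basis 1, z. *)
Variables (re im : K -> F).
Hypothesis char2 : 2%:R != 0 :> F.
Hypothesis cN : forall r, r ^+ 2 != c.
Hypothesis zz : z ^+ 2 = iota c.
Hypothesis coordK : forall x, x = iota (re x) + iota (im x) * z.

Lemma c_neq0 : c != 0. Proof. by have := cN 0; rewrite expr0n eq_sym. Qed.

Lemma coord_eq0 u v : iota u + iota v * z = 0 -> u = 0 /\ v = 0.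
Proof.
have [->|v0] := eqVneq v 0.
  by rewrite rmorph0 mul0r addr0 => /eqP; rewrite fmorph_eq0 => /eqP.
move/eqP; rewrite addr_eq0 => /eqP E; have := cN (u / v); case/eqP.
apply: (fmorph_inj iota); rewrite -zz rmorphXn fmorph_div E.
have v0' : iota v != 0 by rewrite fmorph_eq0.
by field.
Qed.

Lemma char2K : 2%:R != 0 :> K.
Proof. by rewrite -(rmorph_nat iota) fmorph_eq0. Qed.

Hypothesis J : pfister3_zero F.

(** Let N be the norm of t from K to F, t' the conjugate of t, and y a quaternion over
    F of norm N, which exists as norm forms over F are universal. The quaternion
    y - t' has norm N - t' tr(y) + t'^2 = t' (t + t' - tr(y)), a multiple of t' by
    an element f of F. As f and N = t t' are norms, so is t, unless f = 0, in
    which case y - t' is an isotropic vector. *)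
Lemma pfister3_zero_base2 a b t : a != 0 -> b != 0 -> t != 0 ->
  pfister2 (iota a) (iota b) * (1 - wclass1 t) = 0.
Proof.
move=> a0 b0.
have a0' : iota a != 0 by rewrite fmorph_eq0.
have b0' : iota b != 0 by rewrite fmorph_eq0.
have normF u : u != 0 ->
    pfister2 (iota a) (iota b) * wclass1 (iota u) = pfister2 (iota a) (iota b).
  move=> u0; have [x1 [x2 [x3 [x4 E]]]] := qnorm_universal char2 J a0 b0 u0.
  have Ei : qnorm (iota a) (iota b) (iota x1) (iota x2) (iota x3) (iota x4) = iota u.
    by rewrite -E /qnorm !(rmorphXn, rmorphB, rmorphM).
  by rewrite -Ei pfister2_norm // Ei fmorph_eq0.
rewrite (coordK t); set u := re t; set v := im t => t0.
rewrite mulrBr mulr1; apply/eqP; rewrite subr_eq0 eq_sym; apply/eqP.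
have [v0|v0] := eqVneq v 0.
  move: t0; rewrite v0 rmorph0 mul0r addr0 fmorph_eq0; exact: normF.
pose N := u ^+ 2 - c * v ^+ 2.
pose t' := iota u - iota v * z.
have NE : iota N = (iota u + iota v * z) * t'.
  by rewrite /N /t' !(rmorphXn, rmorphB, rmorphM) -zz; ring.
have t'0 : t' != 0.
  apply/eqP => E; have [] := @coord_eq0 u (- v); first by rewrite rmorphN mulNr.
  by move=> _ /eqP; rewrite oppr_eq0 (negPf v0).
have N0 : N != 0 by rewrite -(fmorph_eq0 iota) NE mulf_neq0.
have [y1 [y2 [y3 [y4 E]]]] := qnorm_universal char2 J a0 b0 N0.
pose f := 2%:R * u - 2%:R * y1.
have Ei : qnorm (iota a) (iota b) (iota y1 - t') (iota y2) (iota y3) (iota y4)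
    = t' * iota f.
  have : iota N = qnorm (iota a) (iota b) (iota y1) (iota y2) (iota y3) (iota y4).
    by rewrite -E /qnorm !(rmorphXn, rmorphB, rmorphM).
  rewrite NE /qnorm /f rmorphB !rmorphM rmorph_nat => E'.
  transitivity ((iota u + iota v * z) * t' + t' ^+ 2 - 2%:R * iota y1 * t').
    by rewrite E'; ring.
  by rewrite /t'; ring.
have [f0|f0] := eqVneq f 0.
  rewrite f0 rmorph0 mulr0 in Ei; rewrite (pfister2_isotropic a0' b0' Ei) ?mul0r //.
  have y1u : y1 = u.
    by apply: (mulfI char2); apply/eqP; rewrite eq_sym -subr_eq0 -/f f0.
  rewrite y1u /t' opprB addrCA subrr addr0 mulf_neq0 ?fmorph_eq0 //.
  by apply/eqP => zE; have := c_neq0; rewrite -(fmorph_eq0 iota) -zz zE expr0n eqxx.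
have f0' : iota f != 0 by rewrite fmorph_eq0.
have P1 := @pfister2_norm K _ _ (iota y1 - t') (iota y2) (iota y3) (iota y4) a0' b0'.
rewrite Ei mulf_neq0 // in P1; move: (P1 isT); rewrite wclass1M => {}P1.
have tE : iota u + iota v * z = iota N * t'^-1 by rewrite NE mulfK.
rewrite tE wclass1M wclass1V mulrA (normF _ N0) -{1}(normF _ f0) -mulrA.
rewrite [wclass1 _ * wclass1 _]mulrC.
exact: P1.
Qed.

(** Symbols over K are combinations of symbols with one slot in F. Indeed, unless x
    is in F, y = al + be x with al, be in F. If al or be is zero, <<x, y>> has a
    slot -be or al in F. Otherwise y / al and v = -be x / al have sum 1, so that
    <<y / al, v>> = 0; expanding <<x, y>> bilinearly in terms of v and y / al
    leaves symbols with a slot in F. *)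
Lemma pfister2_base_slot (w : wittRing K) :
  (forall a t, a != 0 -> t != 0 -> pfister2 (iota a) t * w = 0) ->
  forall x y, x != 0 -> y != 0 -> pfister2 x y * w = 0.
Proof.
move=> H x y x0 y0.
have pC a b : pfister2 a b = pfister2 b a by rewrite /pfister2 mulrC.
have [x20|x20] := eqVneq (im x) 0.
  have xE : x = iota (re x) by rewrite {1}(coordK x) x20 rmorph0 mul0r addr0.
  by rewrite xE in x0 *; apply: H => //; rewrite fmorph_eq0 in x0.
pose be := im y / im x; pose al := re y - be * re x.
have yE : y = iota al + iota be * x.
  have x2i : iota (im x) != 0 by rewrite fmorph_eq0.
  rewrite [LHS](coordK y) [X in _ + iota be * X](coordK x) /al rmorphB rmorphM.
  by rewrite /be fmorph_div; field.
clearbody al be.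
have [b0|b0] := eqVneq be 0.
  move: y0; rewrite yE b0 rmorph0 mul0r addr0 fmorph_eq0 => al0.
  by rewrite pC; exact: H.
have [a0|a0] := eqVneq al 0.
  rewrite yE a0 rmorph0 add0r.
  have -> : pfister2 x (iota be * x) = pfister2 (iota (- be)) x.
    have xx := wclass1_mulK x0; rewrite /pfister2 rmorphN wclass1N wclass1M.
    set X := wclass1 x in xx *; set B := wclass1 _.
    transitivity (1 - X - B * X + B * (X * X)); first by ring.
    by rewrite xx; ring.
  by apply: H => //; rewrite oppr_eq0.
have ia0 : iota al != 0 by rewrite fmorph_eq0.
have ib0 : iota be != 0 by rewrite fmorph_eq0.
pose u := y / iota al; pose v := iota (- be / al) * x.
have u0 : u != 0 by rewrite mulf_neq0 // invr_eq0.
have v0 : v != 0 by rewrite mulf_neq0 // fmorph_eq0 mulf_neq0 ?oppr_eq0 ?invr_eq0.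
have uv : u + v = 1.
  by rewrite /u /v {1}yE fmorph_div rmorphN; field.
have := wclass1D u0 v0; rewrite uv oner_neq0 wclass1_1 mul1r => /(_ isT) UV.
have g0 : - al / be != 0 by rewrite mulf_neq0 ?oppr_eq0 ?invr_eq0.
have xE : x = iota (- al / be) * v.
  by rewrite /v !fmorph_div !rmorphN; field; rewrite ia0 ib0.
have yE' : y = iota al * u by rewrite /u mulrC divfK.
have H1 := H _ _ g0 y0; have H2 := H _ _ a0 v0.
clearbody u v; have := UV; rewrite xE yE' /pfister2 in H1 H2 *.
move: H1 H2; rewrite !wclass1M; set G := wclass1 (iota (_ / _)); set A := wclass1 (iota al).
set U := wclass1 u; set V := wclass1 v => H1 H2 UV'.
transitivity ((1 - G) * (1 - A * U) * w + G * ((1 - A) * (1 - V) * w)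
   + G * A * (1 + U * V - (U + V)) * w); first by ring.
by rewrite H1 H2 UV' subrr; ring.
Qed.

Lemma pfister3_zero_ext : pfister3_zero K.
Proof.
move=> x y t x0 y0 t0; apply: pfister2_base_slot => // a y' a0 y'0.
have -> : pfister2 (iota a) y' * (1 - wclass1 t) = pfister2 y' t * (1 - wclass1 (iota a)).
  by rewrite /pfister2; ring.
apply: pfister2_base_slot => // b t' b0 t'0.
have -> : pfister2 (iota b) t' * (1 - wclass1 (iota a)) =
    pfister2 (iota b) (iota a) * (1 - wclass1 t').
  by rewrite /pfister2; ring.
exact: pfister3_zero_base2.
Qed.

Lemma chain_map s t : chain s t -> chain (map iota s) (map iota t).
Proof.
elim=> {s t} [s|s t u _ IH _ IH'|r a s r0|x y a b s n0|a s t _ IH] /=.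
- exact: ChainRefl.
- exact: ChainTrans IH IH'.
- by rewrite rmorphM rmorphXn; apply: ChainSquare; rewrite fmorph_eq0.
- rewrite !(rmorphM, rmorphD, rmorphXn); apply: ChainBinary.
  by rewrite -!(rmorphM, rmorphXn, rmorphD) fmorph_eq0.
- exact: ChainCons.
Qed.

Lemma map_nonzero s : nonzero (map iota s) = nonzero s.
Proof. by rewrite /nonzero all_map; apply: eq_all => x /=; rewrite fmorph_eq0. Qed.

Lemma bil_map s (f g : nat -> K) :
  let f1 i := re (f i) in let f2 i := im (f i) in
  let g1 i := re (g i) in let g2 i := im (g i) in
  bil (map iota s) f g = iota (bil s f1 g1 + c * bil s f2 g2)
     + iota (bil s f1 g2 + bil s f2 g1) * z.
Proof.
elim: s f g => [|a s IH] f g /=; first by rewrite mulr0 !addr0 rmorph0 mul0r addr0.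
rewrite [bil (map _ _) _ _]IH /= /shift.
set B1 := bil s _ _; set B2 := bil s _ _; set B3 := bil s _ _; set B4 := bil s _ _.
have := coordK (f 0%N); have := coordK (g 0%N).
set u1 := re (f 0%N); set u2 := im (f 0%N); set v1 := re (g 0%N); set v2 := im (g 0%N).
by move=> -> ->; rewrite !(rmorphD, rmorphM) -zz; ring.
Qed.

(** An isotropic vector over K is f1 + f2 z with f1, f2 over F orthogonal and
    q(f1) = -c q(f2). Either one of them is isotropic, and a hyperbolic plane
    splits off, or <b, -c b> with b = q(f2) splits off; both are zero over K, and
    the dimension drops. *)
Lemma wclass_ext_eq0 s : nonzero s -> wclass (map iota s) = 0 ->
  exists2 t, nonzero t & wclass s = (1 - wclass1 c) * wclass t.
Proof.
have [n] := ubnP (size s); elim: n s => // n IH [|a s] szs s0 E.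
  by exists [::]; rewrite // wclass_nil mulr0.
have s0' : nonzero (map iota (a :: s)) by rewrite map_nonzero.
have [s' /split_isotropic[f [g [ff gf]]]] := wclass0_split char2K s0' isT E.
rewrite -/(map iota (a :: s)) in ff gf E; move: szs s0 E ff gf {s0'}.
move: (a :: s) => {a}s szs s0 E.
rewrite !bil_map /=.
set f1 := fun i => re (f i); set f2 := fun i => im (f i).
set g1 := fun i => re (g i); set g2 := fun i => im (g i).
move=> /coord_eq0[ff fm] gf.
have f12 : bil s f1 f2 = 0.
  by apply: (mulfI char2); rewrite mulr0 -[RHS]fm [X in _ + X]bil_sym; ring.
have iso_case : isotropic s -> exists2 t, nonzero t & wclass s = (1 - wclass1 c) * wclass t.
  move/(isotropic_split char2 s0)=> [u su].
  have su_sz := chain_size su; have su0 := chain_nonzero su s0.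
  have Eu (R : fieldType) (l : seq R) : wclass (1 :: -1 :: l) = wclass l.
    by rewrite !wclass_cons wclass1N addrA subrr add0r.
  have [|||t t0 Et] := IH u.
  - by move: szs; rewrite su_sz /=; lia.
  - by case/and3P: su0.
  - rewrite -[LHS]Eu -(rmorph1 iota) -rmorphN -[_ :: _]/(map iota (1 :: -1 :: u)).
    by rewrite -(chain_wclass _ (chain_map su)) ?map_nonzero.
  by exists t; rewrite // (chain_wclass s0 su) Eu.
have [f20|f20] := eqVneq (bil s f2 f2) 0.
  have f10 : bil s f1 f1 = 0 by move: ff; rewrite f20 mulr0 addr0.
  have [g11|?] := eqVneq (bil s g1 f1) 0; last by apply: iso_case; exists f1, g1.
  have [g12|?] := eqVneq (bil s g1 f2) 0; last by apply: iso_case; exists f2, g1.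
  have [g21|?] := eqVneq (bil s g2 f1) 0; last by apply: iso_case; exists f1, g2.
  have [g22|?] := eqVneq (bil s g2 f2) 0; last by apply: iso_case; exists f2, g2.
  by move: gf; rewrite g11 g12 g21 g22 mulr0 !addr0 rmorph0 mul0r addr0 eqxx.
have f1E : bil s f1 f1 = - c * bil s f2 f2.
  by apply/eqP; rewrite -subr_eq0 mulNr opprK ff.
have [|u su] := chain_split_pair char2 s0 f20 _ f12.
  by rewrite f1E mulf_neq0 // oppr_eq0 c_neq0.
rewrite f1E in su; set b := bil s f2 f2 in su f20 *.
have su_sz := chain_size su; have su0 := chain_nonzero su s0.
have [|||t t0 Et] := IH u.
- by move: szs; rewrite su_sz /=; lia.
- by case/and3P: su0.
- move: E; rewrite (chain_wclass _ (chain_map su)) ?map_nonzero //= !wclass_cons.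
  rewrite rmorphM rmorphN mulNr wclass1N wclass1M -zz wclass1_sqr.
    by rewrite mul1r addrA subrr add0r.
  by rewrite -sqrf_eq0 zz fmorph_eq0 c_neq0.
exists (b :: t); first by rewrite /= f20.
by rewrite (chain_wclass s0 su) !wclass_cons Et mulNr wclass1N wclass1M; ring.
Qed.

Lemma symbol_sum_ext_eq0 s : nzsym s ->
  symbol_sum [seq (iota p.1, iota p.2) | p <- s] = 0 ->
  exists2 x, x != 0 & symbol_sum s = pfister2 c x.
Proof.
move=> s0 E.
have [|t t0 Et] := wclass_ext_eq0 (symbol_form_nonzero s0).
  rewrite -E -wclass_symbol_form; congr wclass.
  elim: (s) => //= p u IHu; rewrite -/(symbol_form u) IHu.
  by rewrite rmorph1 !rmorphN rmorphM.
rewrite wclass_symbol_form in Et.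
have [x x0 Ex] := pfister_common_slot J c_neq0 t0 (symbol_sum_even char2 s0 c_neq0 cN t0 Et).
by exists x; rewrite // Et.
Qed.

End QuadraticExtension.

(** * Modules over a tensor product of quaternion algebras *)

Section Generators.
Variables (F : fieldType) (R : pzRingType) (iota : F -> R).
Implicit Types (g : seq (R * R)) (s t : seq (F * F)).

Fixpoint all_gens (P : R -> Prop) g : Prop :=
  if g is p :: g' then [/\ P p.1, P p.2 & all_gens P g'] else True.

Lemma all_gens_impl (P Q : R -> Prop) g :
  (forall Z, P Z -> Q Z) -> all_gens P g -> all_gens Q g.
Proof. by move=> PQ; elim: g => //= p g IH [? ? ?]; split; auto. Qed.

Lemma all_gensT (P : R -> Prop) g : (forall Z, P Z) -> all_gens P g.
Proof. by move=> PT; elim: g. Qed.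

Lemma all_gens_cat P g g' : all_gens P g -> all_gens P g' -> all_gens P (g ++ g').
Proof. by move=> Pg Pg'; elim: g Pg => //= p g IH [? ? /IH]. Qed.

(** The function iota embeds the scalars of F in the ring R. *)
Definition quat_rel (c d : F) (X Y : R) :=
  [/\ X * X = iota c, Y * Y = iota d & X * Y = - (Y * X)].

(** Pairs of generators, one for each symbol, that satisfy the quaternion relations
    and commute with the other pairs; equivalently, a homomorphism to R from
    the tensor product of the quaternion algebras. *)
Fixpoint quat_gens s g : Prop :=
  match s, g with
  | [::], [::] => True
  | (c, d) :: s', (X, Y) :: g' =>
    [/\ quat_rel c d X Y, all_gens (GRing.comm X) g',
        all_gens (GRing.comm Y) g' & quat_gens s' g']
  | _, _ => False
  end.

Lemma quat_gens_cat s t g h : quat_gens s g -> quat_gens t h ->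
  all_gens (fun Z => all_gens (GRing.comm Z) h) g -> quat_gens (s ++ t) (g ++ h).
Proof.
move=> sg th; elim: s g sg => [|[c d] s IH] [|[X Y] g] //=.
case=> r X0 Y0 sg [/= Xh Yh gh]; split=> //; try exact: all_gens_cat.
exact: IH.
Qed.
End Generators.

Lemma all_gens_map (R S : pzRingType) (f : R -> S) (P : S -> Prop) g :
  all_gens (fun Z => P (f Z)) g -> all_gens P [seq (f p.1, f p.2) | p <- g].
Proof. by elim: g => //= p g IH [? ? /IH]. Qed.

Lemma all_gens_and (R : pzRingType) (P Q : R -> Prop) g :
  all_gens P g -> all_gens Q g -> all_gens (fun Z => P Z /\ Q Z) g.
Proof. by elim: g => //= p g IH [? ? ?] [? ? ?]; split; auto. Qed.

(** The conditions on f cover homomorphisms, antihomomorphisms, extensions of scalars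
    and maps multiplicative only on a subset P. *)
Lemma quat_gens_map (F K : fieldType) (R S : pzRingType)
    (i : F -> R) (j : K -> S) (h : F -> K) (f : R -> S) (P : R -> Prop) s g :
  (forall X c, P X -> X * X = i c -> f X * f X = j (h c)) ->
  (forall X Y, P X -> P Y -> X * Y = - (Y * X) -> f X * f Y = - (f Y * f X)) ->
  (forall X Y, P X -> P Y -> GRing.comm X Y -> GRing.comm (f X) (f Y)) ->
  all_gens P g -> quat_gens i s g ->
  quat_gens j [seq (h p.1, h p.2) | p <- s] [seq (f p.1, f p.2) | p <- g].
Proof.
move=> fsq fanti fcomm; elim: s g => [|[c d] s IH] [|[X Y] g] //=.
case=> PX PY Pg [[XX YY XY] Xg Yg sg]; split; last exact: IH.
- by split; [exact: fsq | exact: fsq | exact: fanti].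
- apply/all_gens_map; apply: all_gens_impl (all_gens_and Pg Xg) => Z [PZ]; exact: fcomm.
- apply/all_gens_map; apply: all_gens_impl (all_gens_and Pg Yg) => Z [PZ]; exact: fcomm.
Qed.

Section StepInvariance.
Variables (F : fieldType) (R : pzRingType) (iota : {rmorphism F -> R}).
Hypothesis iotaC : forall c Z, GRing.comm (iota c) Z.
Implicit Types (s t : seq (F * F)) (X Y Z U : R).

Lemma twist_mul X Y U U' : X * U = U' * X -> (U * X) * (U * Y) = U * U' * (X * Y).
Proof. by move=> XU; rewrite !mulrA -(mulrA U X U) XU !mulrA. Qed.

Definition twist x y W := iota x + iota y * W.

(** An element that anticommutes with W conjugates x + y W into x - y W. *)
Lemma twist_anti x y W X : X * W = - (W * X) -> X * twist x y W = twist x (- y) W * X.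
Proof.
move=> XW; rewrite /twist mulrDr mulrDl rmorphN mulNr -(iotaC x) mulrA -(iotaC y).
by rewrite -mulrA XW mulrN mulrA mulNr.
Qed.

Lemma twist_norm x y n W : W * W = iota n ->
  twist x y W * twist x (- y) W = iota (x ^+ 2 - y ^+ 2 * n).
Proof.
move=> WW; rewrite /twist mulrDl !mulrDr rmorphN mulNr !mulrN.
have -> : iota y * W * iota x = iota x * (iota y * W) by exact/esym/iotaC.
have -> : iota y * W * (iota y * W) = iota (y ^+ 2 * n).
  by rewrite -mulrA (mulrA W) -(iotaC y W) -(mulrA _ W) WW -!rmorphM expr2 mulrA.
by rewrite addrA subrK -rmorphM -rmorphB expr2.
Qed.

Lemma comm_twist x y W Z : GRing.comm Z W -> GRing.comm Z (twist x y W).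
Proof.
move=> ZW; apply: commrD; first exact/commr_sym/iotaC.
by apply: commrM => //; exact/commr_sym/iotaC.
Qed.

Lemma comm_twist_self x y W : GRing.comm (twist x y W) W.
Proof. exact/commr_sym/comm_twist. Qed.

(** Multiplying X by x + y W multiplies its square by the norm of x + y W: all three
    steps are instances. *)
Lemma twist_sqr x y n W X c : W * W = iota n -> X * W = - (W * X) ->
  X * X = iota c ->
  (twist x y W * X) * (twist x y W * X) = iota ((x ^+ 2 - y ^+ 2 * n) * c).
Proof.
by move=> WW XW XX; rewrite (twist_mul _ (twist_anti x y XW)) (twist_norm _ _ WW) XX -rmorphM.
Qed.

Lemma anti_mul U X Y : GRing.comm U Y -> X * Y = - (Y * X) -> U * X * Y = - (Y * (U * X)).
Proof. by move=> UY XY; rewrite -mulrA XY mulrN !mulrA UY. Qed.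

Lemma anti_sym X Y : X * Y = - (Y * X) -> Y * X = - (X * Y).
Proof. by move=> ->; rewrite opprK. Qed.

Lemma all_gens_comm_twist x y W X g : all_gens (GRing.comm W) g ->
  all_gens (GRing.comm X) g -> all_gens (GRing.comm (twist x y W * X)) g.
Proof.
move=> Wg Xg; apply: all_gens_impl (all_gens_and Wg Xg) => Z [WZ XZ].
by apply: commr_sym; apply: commrM; [apply/comm_twist/commr_sym | exact: commr_sym].
Qed.

(** [ElemStep2] and [ElemStep3] multiply one generator by an element x + y Y or
    x + y X of its quaternion algebra; [ElemStep1] multiplies Y and Y' by x + X X',
    where X X' has square c c' and anticommutes with both. The new generators are
    polynomials in the old ones, so they still commute with whatever commuted
    with those. *)
Lemma quat_gens_elem_step s t g : elem_step s t -> quat_gens iota s g ->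
  exists g', quat_gens iota t g' /\
    forall Z, all_gens (GRing.comm Z) g -> all_gens (GRing.comm Z) g'.
Proof.
have ctx u s' t' : (forall g, quat_gens iota s' g -> exists g', quat_gens iota t' g' /\
      forall Z, all_gens (GRing.comm Z) g -> all_gens (GRing.comm Z) g') ->
    forall g, quat_gens iota (u ++ s') g -> exists g', quat_gens iota (u ++ t') g' /\
      forall Z, all_gens (GRing.comm Z) g -> all_gens (GRing.comm Z) g'.
  move=> H; elim: u => //= -[c d] u IH [|[X Y] k] //= [r Xk Yk /IH[k' [uk' kk']]].
  exists ((X, Y) :: k'); split; first by split; auto.
  by move=> Z [ZX ZY Zk]; split; auto.
case=> [s1 s2 c d c' d' x|s1 s2 c d x y|s1 s2 c d x y]; apply: ctx => {}g /=.
- case: g => [//|[X Y] [|[X' Y'] g]]; first by case.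
  case=> -[XX YY XY] [/= XX' XY' Xg] [/= YX' YY' Yg] [[X'X' Y'Y' X'Y'] X'g Y'g sg].
  pose W := X * X'.
  have WW : W * W = iota (c * c').
    by rewrite /W mulrA -(mulrA X X' X) -XX' mulrA XX -mulrA X'X' -rmorphM.
  have YW : Y * W = - (W * Y).
    by rewrite /W mulrA (anti_sym XY) mulNr -mulrA YX' mulrA.
  have Y'W : Y' * W = - (W * Y').
    by rewrite /W mulrA -XY' -mulrA (anti_sym X'Y') mulrN mulrA.
  have XW : GRing.comm X W by apply: commrM => //.
  have X'W : GRing.comm X' W by apply: commrM => //; exact: commr_sym.
  have Wg : all_gens (GRing.comm W) g.
    apply: all_gens_impl (all_gens_and Xg X'g) => Z [ZX ZX'].
    by apply/commr_sym/commrM; exact: commr_sym.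
  pose U := twist x 1 W.
  have nE : x ^+ 2 - c * c' = x ^+ 2 - 1 ^+ 2 * (c * c') by rewrite expr1n mul1r.
  exists ((X, U * Y) :: (X', U * Y') :: g); split; first split; first split => //.
  + by rewrite nE; exact: twist_sqr.
  + by apply: anti_sym; apply: anti_mul (anti_sym XY); exact/commr_sym/comm_twist.
  + by split=> //; apply: commrM => //; exact: comm_twist.
  + split; last exact: all_gens_comm_twist.
      by apply/commr_sym/commrM; [exact: comm_twist | exact: commr_sym].
    rewrite /GRing.comm (twist_mul _ (twist_anti x 1 YW)) (twist_mul _ (twist_anti x 1 Y'W)).
    by rewrite YY'.
  + split=> //; last exact: all_gens_comm_twist.
    split=> //; first by rewrite nE; exact: twist_sqr.
    by apply: anti_sym; apply: anti_mul (anti_sym X'Y'); exact/commr_sym/comm_twist.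
  + move=> Z [/= ZX ZY [ZX' ZY' Zg]].
    have ZU : GRing.comm Z U by apply: comm_twist; exact: commrM.
    by split=> //=; [exact: commrM | split=> //; exact: commrM].
- case: g => [//|[X Y] g] [[XX YY XY] Xg Yg sg].
  exists ((twist x y Y * X, Y) :: g); split; first split=> //.
  + split=> //; first exact: twist_sqr.
    by apply: anti_mul => //; exact: comm_twist_self.
  + exact: all_gens_comm_twist.
  + by move=> Z [/= ZX ZY Zg]; split=> //=; apply: commrM => //; exact: comm_twist.
- case: g => [//|[X Y] g] [[XX YY XY] Xg Yg sg].
  have YX := anti_sym XY.
  exists ((X, twist x y X * Y) :: g); split; first split=> //.
  + split=> //; first exact: twist_sqr.
    by apply: anti_sym; apply: anti_mul => //; exact: comm_twist_self.
  + exact: all_gens_comm_twist.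
  + by move=> Z [/= ZX ZY Zg]; split=> //=; apply: commrM => //; exact: comm_twist.
Qed.

End StepInvariance.

Section Modules.
Variable F : fieldType.
Implicit Types (s t : seq (F * F)).

(** A representation of dimension N, given by matrices so that it extends to larger
    fields entrywise. *)
Definition has_module s N := exists g, quat_gens (@scalar_mx F N) s g.

Lemma has_module_sconn s t N : sconn s t -> has_module s N -> has_module t N.
Proof.
elim=> {s t} [s t [st _] [g sg]|//|s t u _ IH _ IH' /IH/IH'//].
have iC c (Z : 'M[F]_N) : GRing.comm c%:M Z.
  exact/esym/scalar_mxC.
by have [g' [tg' _]] := quat_gens_elem_step iC st sg; exists g'.
Qed.

Lemma has_module_ext (K : fieldType) (i : {rmorphism F -> K}) s N :
  has_module s N ->
  exists g, quat_gens (@scalar_mx K N) [seq (i p.1, i p.2) | p <- s] g.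
Proof.
case=> g sg; exists [seq (map_mx i p.1, map_mx i p.2) | p <- g].
apply: (quat_gens_map (P := fun=> True) _ _ _ _ sg) => [X c _|X Y _ _|X Y _ _|].
- by move=> XX; rewrite -map_scalar_mx -XX; exact/esym/map_mxM.
- by move=> XY; rewrite -[LHS]map_mxM -[X in - X]map_mxM -map_mxN; congr map_mx.
- by move=> XY; rewrite /GRing.comm -[LHS]map_mxM -[RHS]map_mxM; congr map_mx.
- exact: all_gensT.
Qed.

Hypothesis char2 : 2%:R != 0 :> F.

(** The eigenspaces of X for e and -e are exchanged by Y, so each has half the
    dimension; the generators of the other factors commute with X and act on the
    eigenspace. *)
Lemma has_module_split e d s N : e != 0 -> d != 0 ->
  has_module ((e ^+ 2, d) :: s) N -> exists2 M, N = M.*2 & has_module s M.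
Proof.
move=> e0 d0 [[|[X Y] g] //= [[XX YY XY] Xg _ sg]].
pose A : 'M[F]_N := X - e%:M; pose B : 'M[F]_N := X + e%:M.
have {}XX : X *m X = (e ^+ 2)%:M := XX.
have {}YY : Y *m Y = d%:M := YY.
have {}XY : X *m Y = - (Y *m X) := XY.
have eC U : e%:M *m U = U *m e%:M by exact/esym/scalar_mxC.
have AB : A *m B = 0.
  rewrite /A /B mulmxDr !mulmxBl XX eC subrKA.
  by rewrite -scalar_mxM -expr2 subrr.
have YA : Y *m A = - (B *m Y).
  rewrite /A /B mulmxBr mulmxDl eC opprD; congr (_ - _).
  by rewrite XY opprK.
have YdY : Y *m (d^-1 *: Y) = 1%:M.
  by rewrite -scalemxAr YY scale_scalar_mx mulVf.
have [Yu _] := mulmx1_unit YdY.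
have rAB : \rank A = \rank B.
  have -> : \rank A = \rank (Y *m A) by rewrite eqmxMfull ?row_full_unit.
  by rewrite YA mxrank_opp mxrankMfree // row_free_unit.
have BA : B - A = (e *+ 2)%:M.
  by rewrite /A /B opprB addrC addrA subrK mulr2n raddfD.
have rBA : \rank (B - A)%R = N.
  rewrite BA mxrank_unit // unitmxE det_scalar unitfE expf_neq0 //.
  by rewrite -mulr_natr mulf_neq0.
(* A B = 0 and B - A invertible bound the sum of the two equal ranks from both
   sides. *)
have rle := mulmx0_rank_max AB.
have rge := mxrank_add B (- A); rewrite mxrank_opp rBA in rge.
pose V := row_base (kermx A); pose M := \rank (kermx A).
have ME : N = M.*2 by rewrite /M mxrank_ker; lia.
have Vfree : row_free V by exact: row_base_free.
have stab U : GRing.comm X U -> U \in [pred f | stablemx V f].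
  move=> XU; rewrite inE stablemx_row_base; apply: comm_mx_stable_ker.
  by rewrite /comm_mx /A mulmxBl mulmxBr eC; congr (_ - _).
have cM U W : GRing.comm X U -> GRing.comm X W ->
  conjmx V U *m conjmx V W = conjmx V (U *m W).
  by move=> XU XW; rewrite conjmxM //; exact: stab.
exists M => //; exists [seq (conjmx V p.1, conjmx V p.2) | p <- g].
have := quat_gens_map (f := conjmx V) (j := @scalar_mx F M) (h := id) _ _ _ Xg sg.
rewrite (eq_map (g := id)) ?map_id; last by case.
apply.
- move=> U c XU UU; rewrite -[LHS]/(conjmx V U *m conjmx V U) cM //.
  by rewrite -[U *m U]/(U * U) UU conjmx_scalar.
- move=> U W XU XW UW; rewrite -[LHS]/(conjmx V U *m conjmx V W) cM //.
  rewrite -[U *m W]/(U * W) UW /conjmx mulmxN mulNmx; congr (- _).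
  exact/esym/cM.
- move=> U W XU XW UW; rewrite /GRing.comm -[LHS]/(conjmx V U *m conjmx V W) cM //.
  by rewrite -[U *m W]/(U * W) UW; exact/esym/cM.
Qed.

End Modules.

(** * Split tensor products *)

(** For a nonzero vector v the linear map from quaternions u to v u goes from
    dimension 4 to dimension 2, so v u = 0 for some u <> 0; multiplying by the
    conjugate of u shows that the norm of u vanishes. *)
Lemma has_module2_pfister (F : fieldType) (c d : F) : c != 0 -> d != 0 ->
  has_module [:: (c, d)] 2 -> pfister2 c d = 0.
Proof.
move=> c0 d0 [[|[X Y] g] //= [[XX YY XY] _ _ _]].
pose v : 'rV[F]_2 := delta_mx 0 0.
pose B := \matrix_(i < 4) nth 0 [:: v; v *m X; v *m Y; v *m X *m Y] i.
have : kermx B != 0.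
  by rewrite -mxrank_eq0 mxrank_ker -lt0n subn_gt0 (leq_ltn_trans (rank_leq_col _)).
case/rowV0Pn=> u /sub_kermxP uB u0.
pose x i := u 0 i.
have uBE : u *m B = x 0 *: v + x 1 *: (v *m X) + x 2 *: (v *m Y) + x 3 *: (v *m X *m Y).
  rewrite mulmx_sum_row /B !big_ord_recl big_ord0 !rowK /= addr0 !addrA /x.
  by congr (_ + _ + _ + _); congr (u 0 _ *: _); apply: val_inj.
have vq : v *m ((x 0)%:M + (x 1) *: X + ((x 2)%:M + (x 3) *: X) *m Y) = 0.
  rewrite -uB uBE mulmxDl !mulmxDr mul_mx_scalar mul_scalar_mx !addrA.
  by rewrite -!scalemxAl -!scalemxAr !mulmxA.
have {}XX : X *m X = c%:M := XX.
have {}YY : Y *m Y = d%:M := YY.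
have {}XY : X *m Y = - (Y *m X) := XY.
have vP1 : v 0 0 != 0 by rewrite mxE oner_neq0.
suff E : ((x 0)%:M + (x 1) *: X + ((x 2)%:M + (x 3) *: X) *m Y) *m
    ((x 0)%:M - (x 1) *: X - ((x 2)%:M + (x 3) *: X) *m Y) =
    (qnorm c d (x 0) (x 1) (x 2) (x 3))%:M.
  have /(congr1 (fun M => v *m M)) := E; rewrite mulmxA vq mul0mx mul_mx_scalar.
  move/esym/eqP; rewrite scaler_eq0 => /orP[/eqP q0|/eqP v0]; last first.
    by rewrite v0 mxE eqxx in vP1.
  apply: pfister2_isotropic q0 _ => //.
  apply: contraNT u0; rewrite !negb_or !negbK => /and4P[/eqP x0 /eqP x1 /eqP x2 /eqP x3].
  apply/eqP/rowP; case=> [[|[|[|[|//]]]] i]; rewrite mxE.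
  - by rewrite -[RHS]x0; congr (u 0 _); apply: val_inj.
  - by rewrite -[RHS]x1; congr (u 0 _); apply: val_inj.
  - by rewrite -[RHS]x2; congr (u 0 _); apply: val_inj.
  - by rewrite -[RHS]x3; congr (u 0 _); apply: val_inj.
have YX : Y *m X = - (X *m Y) by rewrite XY opprK.
have comm a b a' b' : (a%:M + b *: X) *m (a'%:M + b' *: X) =
    (a'%:M + b' *: X) *m (a%:M + b *: X).
  rewrite !mulmxDl !mulmxDr -!scalemxAl -!scalemxAr !mul_mx_scalar !mul_scalar_mx.
  rewrite !scale_scalar_mx !scalerA (mulrC a' a) (mulrC b' b) -!addrA.
  by congr (_ + _); rewrite !addrA; congr (_ + _); exact: addrC.
have norm a b : (a%:M + b *: X) *m (a%:M - b *: X) = (a ^+ 2 - c * b ^+ 2)%:M.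
  rewrite mulmxDl !mulmxDr !mulmxN -!scalemxAl -!scalemxAr XX !mul_mx_scalar mul_scalar_mx.
  rewrite addrA subrK scale_scalar_mx !scale_scalar_mx -raddfB /=.
  by congr (_%:M); ring.
have swap a b : Y *m (a%:M + b *: X) = (a%:M - b *: X) *m Y.
  by rewrite mulmxDr mulmxBl mul_scalar_mx mul_mx_scalar -scalemxAr YX scalerN -scalemxAl.
have swap' a b : Y *m (a%:M - b *: X) = (a%:M + b *: X) *m Y.
  by rewrite -scaleNr swap scaleNr opprK.
have key (P P' R R' : 'M[F]_2) m n : P *m P' = m%:M -> R *m R' = n%:M ->
    Y *m P' = P *m Y -> Y *m R = R' *m Y -> P *m R = R *m P ->
    (P + R *m Y) *m (P' - R *m Y) = (m - d * n)%:M.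
  move=> PP RR YP YR PR; rewrite mulmxBr !mulmxDl PP.
  have -> : R *m Y *m P' = P *m (R *m Y) by rewrite -mulmxA YP !mulmxA PR.
  have -> : R *m Y *m (R *m Y) = (d * n)%:M.
    rewrite -mulmxA (mulmxA Y) YR -(mulmxA R') YY mulmxA RR -scalar_mxM.
    by rewrite mulrC.
  by rewrite opprD addrA addrK raddfB.
by rewrite (key _ _ _ _ _ _ (norm _ _) (norm _ _) (swap' _ _) (swap _ _) (comm _ _ _ _)).
Qed.

(** The extension F[X] / (X^2 - c), in coordinates. *)
Lemma quadratic_extension (F : fieldType) (c : F) : (forall r, r ^+ 2 != c) ->
  exists (K : fieldType) (iota : {rmorphism F -> K}) (z : K) (re im : K -> F),
    z ^+ 2 = iota c /\ forall x, x = iota (re x) + iota (im x) * z.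
Proof.
move=> cN; pose p : {poly F} := 'X^2 - c%:P.
have szp : size p = 3 by rewrite size_XnsubC.
have irr : irreducible_poly p.
  apply: cubic_irreducible; rewrite ?szp // => x.
  by rewrite rootE !hornerE subr_eq0.
have [L _ [z rz gen]] := irredp_FAdjoin irr.
pose i : {rmorphism F -> L} := in_alg L.
have zz : z ^+ 2 = i c.
  move: rz; rewrite rootE rmorphB /= map_polyXn map_polyC /= !hornerE subr_eq0.
  by move/eqP.
have H x : exists uv : F * F, x = i uv.1 + i uv.2 * z.
  have /Fadjoin_polyP[q /polyOver1P[q' ->] ->] : x \in <<1; z>>%VS by rewrite gen memvf.
  rewrite (divp_eq q' p) rmorphD rmorphM /= hornerD hornerM (rootP rz) mulr0 add0r.
  have sz : (size (q' %% p)%R <= 2)%N.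
    by have := ltn_modp q' p; rewrite -size_poly_eq0 szp.
  exists ((q' %% p)`_0, (q' %% p)`_1) => /=.
  rewrite (horner_coef_wide z (n := 2)) ?size_map_poly // !big_ord_recl big_ord0 /=.
  by rewrite !coef_map /= expr0 mulr1 addr0 expr1.
exists L, i, z, (fun x => (projT1 (cid (H x))).1), (fun x => (projT1 (cid (H x))).2).
by split=> // x; exact: (projT2 (cid (H x))).
Qed.

Lemma has_module_ones (F : fieldType) (char2 : 2%:R != 0 :> F) k (s : seq (F * F)) N :
  has_module (nseq k (1, 1) ++ s) (2 ^ k * N) -> has_module s N.
Proof.
elim: k N => [|k IH] N /=; first by rewrite mul1n.
have := @has_module_split F char2 1 1 (nseq k (1, 1) ++ s) (2 ^ k.+1 * N).
rewrite expr1n oner_neq0 => H /(H isT isT)[M ME].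
by have -> : M = (2 ^ k * N)%N by [move: ME; rewrite expnS; lia]; exact: IH.
Qed.

Lemma symbol_sum_cat (F : fieldType) (s t : seq (F * F)) :
  symbol_sum (s ++ t) = symbol_sum s + symbol_sum t.
Proof. exact: big_cat. Qed.

Lemma symbol_sum_ones (F : fieldType) k : symbol_sum (nseq k (1, 1)) = 0 :> wittRing F.
Proof.
rewrite /symbol_sum; elim: k => [|k IH]; rewrite ?big_nil // big_cons IH.
by rewrite /pfister2 wclass1_1 subrr mul0r addr0.
Qed.

(** A tensor product of m quaternion algebras with a module of dimension 2^m is a
    matrix algebra. The statement quantifies over the field, since the induction
    passes to a quadratic extension. *)
Lemma split_symbol_sum m (F : fieldType) (s : seq (F * F)) :
  2%:R != 0 :> F -> pfister3_zero F -> nzsym s -> size s = m ->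
  has_module s (2 ^ m) -> symbol_sum s = 0.
Proof.
elim: m F s => [|m IH] F [|[c d] s] // char2 J; first by move=> *; rewrite /symbol_sum big_nil.
case/andP=> /andP[/= c0 d0] s0 [sz] mod_s.
have sum_cons : symbol_sum ((c, d) :: s) = pfister2 c d + symbol_sum s.
  by rewrite /symbol_sum big_cons.
have [[e ce]|cN] := pselect (exists e, e ^+ 2 = c).
  have e0 : e != 0 by rewrite -sqrf_eq0 ce.
  rewrite -ce in mod_s; have [M ME mod_s'] := has_module_split char2 e0 d0 mod_s.
  rewrite sum_cons (IH _ s) // /pfister2; last first.
    by have <- : M = (2 ^ m)%N by [move: ME; rewrite expnS; lia].
  by rewrite -ce wclass1_sqr // subrr mul0r addr0.
have {}cN r : r ^+ 2 != c by apply/eqP => E; apply: cN; exists r.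
have [K [i [z [re [im [zz xE]]]]]] := quadratic_extension cN.
have char2K : 2%:R != 0 :> K := char2K i char2.
have JK := pfister3_zero_ext char2 cN zz xE J.
have z0 : z != 0 by rewrite -sqrf_eq0 zz fmorph_eq0.
have d0' : i d != 0 by rewrite fmorph_eq0.
have [g] := has_module_ext i mod_s; rewrite /= -zz => mod_K.
have [M ME mod_s'] := has_module_split char2K z0 d0' (ex_intro _ g mod_K).
have sK0 : symbol_sum [seq (i p.1, i p.2) | p <- s] = 0.
  apply: IH => //; rewrite ?size_map //.
    by rewrite /nzsym all_map; apply: sub_all s0 => p /=; rewrite !fmorph_eq0.
  by have <- : M = (2 ^ m)%N by [move: ME; rewrite expnS; lia].
have [x x0 Ex] := symbol_sum_ext_eq0 char2 cN zz xE J s0 sK0.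
have dx0 : d * x != 0 by rewrite mulf_neq0.
have sumE : symbol_sum ((c, d) :: s) = pfister2 c (d * x).
  rewrite sum_cons Ex; apply/eqP; rewrite -subr_eq0; apply/eqP.
  by rewrite -[RHS](J _ _ _ c0 d0 x0) /pfister2 wclass1M; ring.
pose t := nseq m (1, 1) ++ [:: (c, d * x)].
have t0 : nzsym t.
  by rewrite /nzsym all_cat all_nseq /= !oner_neq0 orbT c0 dx0.
(* Comparing with t brings the module of the given presentation to one of the
   single symbol (c, d x). *)
have conn : sconn ((c, d) :: s) t.
  apply: symbol_sum_sconn => //.
  - by rewrite /= c0 d0.
  - by rewrite /t size_cat size_nseq /= sz addn1.
  - by rewrite sumE symbol_sum_cat symbol_sum_ones add0r /symbol_sum big_seq1.
have := has_module_sconn conn mod_s; rewrite expnSr => /(has_module_ones char2).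
by move/(has_module2_pfister c0 dx0); rewrite sumE.
Qed.

(** * The bimodule of an isomorphism *)

Section Bimodule.
Variable F : fieldType.

Lemma tensor_quat_gens (s : seq (F * F)) :
  exists g, quat_gens (fun c => c%:A : tensor_quat s) s g.
Proof.
elim: s => [|[c d] s [g sg]]; first by exists [::].
pose A := quat c d; pose B := tensor_quat s.
exists ((pure (quat_x c d) (1 : B), pure (quat_y c d) (1 : B)) ::
        [seq (pure (1 : A) p.1, pure (1 : A) p.2) | p <- g]).
split.
- split; rewrite !pureM mul1r.
  + by rewrite quat_xx pureZl.
  + by rewrite quat_yy pureZl.
  + by rewrite quat_xy -scaleN1r pureZl scaleN1r.
- apply: all_gens_map; apply: all_gensT => Z.
  by rewrite /GRing.comm !pureM !mulr1 !mul1r.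
- apply: all_gens_map; apply: all_gensT => Z.
  by rewrite /GRing.comm !pureM !mulr1 !mul1r.
have := quat_gens_map (f := pure (1 : A)) (j := fun c => c%:A : tensor A B)
  (h := id) (P := fun=> True) _ _ _ (all_gensT _ _) sg.
rewrite (eq_map (g := id)) ?map_id; last by case.
apply=> //.
- by move=> X e _ XX; rewrite pureM mul1r XX pureZr.
- by move=> X Y _ _ XY; rewrite !pureM mul1r XY -scaleN1r pureZr scaleN1r.
- by move=> X Y _ _ XY; rewrite /GRing.comm !pureM mul1r XY.
Qed.

Lemma dim_tensor_quat (s : seq (F * F)) : dim (tensor_quat s) = (2 ^ (size s + size s))%N.
Proof.
elim: s => [//|[c d] s IH].
have -> : dim (tensor_quat ((c, d) :: s)) = (4 * dim (tensor_quat s))%N by [].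
by rewrite IH /= addSn addnS !expnS mulnA.
Qed.

Variable A : falgType F.

Definition left_mx (a : A) : 'M[F]_(dim A) := lin1_mx (v2r \o amull a \o r2v).
Definition right_mx (a : A) : 'M[F]_(dim A) := lin1_mx (v2r \o amulr a \o r2v).

Lemma mul_left_mx r a : r *m left_mx a = v2r (a * r2v r).
Proof. by rewrite mul_rV_lin1 /= lfunE. Qed.

Lemma mul_right_mx r a : r *m right_mx a = v2r (r2v r * a).
Proof. by rewrite mul_rV_lin1 /= lfunE. Qed.

Lemma mx_eq_rV n (M N : 'M[F]_n) : (forall r : 'rV_n, r *m M = r *m N) -> M = N.
Proof. by move=> H; apply/row_matrixP => i; rewrite !rowE. Qed.

Lemma left_mxM a b : left_mx a *m left_mx b = left_mx (b * a).
Proof. by apply: mx_eq_rV => r; rewrite mulmxA !mul_left_mx v2rK mulrA. Qed.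

Lemma right_mxM a b : right_mx a *m right_mx b = right_mx (a * b).
Proof. by apply: mx_eq_rV => r; rewrite mulmxA !mul_right_mx v2rK mulrA. Qed.

Lemma left_right_mx a b : left_mx a *m right_mx b = right_mx b *m left_mx a.
Proof.
apply: mx_eq_rV => r.
by rewrite !mulmxA !(mul_left_mx, mul_right_mx) !v2rK mulrA.
Qed.

Lemma left_mx_scalar c : left_mx c%:A = c%:M.
Proof.
by apply: mx_eq_rV => r; rewrite mul_left_mx mulr_algl linearZ /= r2vK mul_mx_scalar.
Qed.

Lemma right_mx_scalar c : right_mx c%:A = c%:M.
Proof.
by apply: mx_eq_rV => r; rewrite mul_right_mx mulr_algr linearZ /= r2vK mul_mx_scalar.
Qed.

Lemma left_mxN a : left_mx (- a) = - left_mx a.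
Proof.
by apply: mx_eq_rV => r; rewrite mulmxN !mul_left_mx mulNr linearN.
Qed.

Lemma right_mxN a : right_mx (- a) = - right_mx a.
Proof.
by apply: mx_eq_rV => r; rewrite mulmxN !mul_right_mx mulrN linearN.
Qed.

(** Left and right multiplications commute. With matrices acting on row vectors, left
    multiplication is an antihomomorphism, but the quaternion relations are symmetric
    under reversal of products. *)
Lemma bimodule s t g h : quat_gens (fun c => c%:A : A) s g ->
  quat_gens (fun c => c%:A : A) t h -> has_module (s ++ t) (dim A).
Proof.
move=> sg th.
exists ([seq (left_mx p.1, left_mx p.2) | p <- g] ++
        [seq (right_mx p.1, right_mx p.2) | p <- h]).
apply: quat_gens_cat; last first.
- apply: all_gens_map; apply: all_gensT => a.
  apply: all_gens_map; apply: all_gensT => b.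
  exact: left_right_mx.
- have := quat_gens_map (f := right_mx) (j := @scalar_mx F (dim A))
    (h := id) (P := fun=> True) _ _ _ (all_gensT _ _) th.
  rewrite (eq_map (g := id)) ?map_id; last by case.
  apply=> //.
  + by move=> X c _ XX; rewrite -right_mx_scalar -XX; exact: right_mxM.
  + move=> X Y _ _ XY; rewrite -[LHS]/(right_mx X *m right_mx Y) right_mxM XY right_mxN.
    by congr (- _); exact/esym/right_mxM.
  + move=> X Y _ _ XY; rewrite /GRing.comm -[LHS]/(right_mx X *m right_mx Y).
    by rewrite right_mxM XY; exact/esym/right_mxM.
- have := quat_gens_map (f := left_mx) (j := @scalar_mx F (dim A))
    (h := id) (P := fun=> True) _ _ _ (all_gensT _ _) sg.
  rewrite (eq_map (g := id)) ?map_id; last by case.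
  apply=> //.
  + by move=> X c _ XX; rewrite -left_mx_scalar -XX; exact: left_mxM.
  + move=> X Y _ _ XY; rewrite -[X in _ = - X]/(left_mx Y *m left_mx X) left_mxM XY left_mxN.
    by rewrite opprK; exact: left_mxM.
  + move=> X Y _ _ XY; rewrite /GRing.comm -[RHS]/(left_mx Y *m left_mx X).
    by rewrite left_mxM XY; exact: left_mxM.
Qed.

End Bimodule.

Lemma isomorphic_module (F : fieldType) (s t : seq (F * F)) :
  isomorphic (tensor_quat s) (tensor_quat t) ->
  has_module (s ++ t) (2 ^ (size t + size t)).
Proof.
case=> f _; have [g sg] := tensor_quat_gens s; have [h th] := tensor_quat_gens t.
rewrite -dim_tensor_quat; apply: (bimodule (g := [seq (f p.1, f p.2) | p <- g])) th.
have := quat_gens_map (f := f) (j := fun c => c%:A : tensor_quat t)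
    (h := id) (P := fun=> True) _ _ _ (all_gensT _ _) sg.
rewrite (eq_map (g := id)) ?map_id; last by case.
apply=> //.
- by move=> X c _ XX; rewrite -rmorphM XX /= linearZ /= rmorph1.
- by move=> X Y _ _ XY; rewrite -!rmorphM XY rmorphN.
- by move=> X Y _ _ XY; rewrite /GRing.comm -!rmorphM XY.
Qed.

(** * Quadratic forms and threefold Pfister forms *)

Section PfisterForms.
Variable F : fieldType.
Hypothesis char2 : 2%:R != 0 :> F.

Fact qpfister1_subproof (a : F) :
  quadratic (fun v : 'rV[F]_2 => v 0 0 ^+ 2 - a * v 0 1 ^+ 2).
Proof.
split=> [c v | u c v w]; first by rewrite !mxE; ring.
by rewrite /polar !mxE /=; ring.
Qed.
Definition qpfister1 a := QForm (qpfister1_subproof a).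

Lemma Iq1_pfister1 a : a != 0 -> Iq 1 (qpfister1 a).
Proof.
move=> a0; split=> // u Hu.
have polE v : polar (qpfister1 a) u v = 2%:R * (u 0 0 * v 0 0 - a * (u 0 1 * v 0 1)).
  by rewrite /polar /= !mxE; ring.
have d2 (i j : 'I_2) : (delta_mx 0 i : 'rV[F]_2) 0 j = (j == i)%:R by rewrite mxE.
have u0 : u 0 0 = 0.
  have := Hu (delta_mx 0 0); rewrite polE !d2 /= mulr1 !mulr0 subr0.
  by move/eqP; rewrite mulf_eq0 (negPf char2) => /eqP.
have u1 : u 0 1 = 0.
  have := Hu (delta_mx 0 1); rewrite polE !d2 /= mulr1 mulr0 sub0r.
  by move/eqP; rewrite mulf_eq0 (negPf char2) oppr_eq0 mulf_eq0 (negPf a0) => /eqP.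
apply/rowP; case=> [[|[|//]]] i; rewrite mxE.
- by rewrite -[RHS]u0; congr (u _ _); apply: val_inj.
- by rewrite -[RHS]u1; congr (u _ _); apply: val_inj.
Qed.

Definition qpfister2 a b := qsum (qpfister1 a) (qscale (- b) (qpfister1 a)).
Definition qpfister3 a b c := qsum (qpfister2 a b) (qscale (- c) (qpfister2 a b)).

Lemma Iq3_pfister3 a b c : a != 0 -> b != 0 -> c != 0 -> Iq 3 (qpfister3 a b c).
Proof.
move=> a0 b0 c0; apply: WittGen; exists c, (qpfister2 a b); split=> //.
by apply: WittGen; exists b, (qpfister1 a); split=> //; exact: Iq1_pfister1.
Qed.

Lemma qval0 (q : qform F) : q 0 = 0.
Proof. by have [qZ _] := qvalP q; rewrite -(scale0r 0) qZ expr0n mul0r. Qed.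

Lemma qdim_add_hyperbolic k (q : qform F) : (qdim q <= qdim (add_hyperbolic k q))%N.
Proof. by elim: k => //= k /leq_trans; apply; exact: leq_addr. Qed.

(** For reasons of dimension q is isometric to a sum of at least one hyperbolic
    plane, an isotropic vector of which is pulled back to q. *)
Lemma witt_equiv_qzero_isotropic (q : qform F) : (0 < qdim q)%N ->
  witt_equiv q (qzero F) -> exists2 v, v != 0 & q v = 0.
Proof.
move=> q0 [k [] [f [bf qf]]]; last first.
  have dpos := leq_trans q0 (qdim_add_hyperbolic k q).
  have [h _ hf] := bf; have := hf (const_mx 1).
  rewrite (thinmx0 (h _)) linear0 => /rowP/(_ (Ordinal dpos)).
  by rewrite !mxE => /esym/eqP; rewrite oner_eq0.
have [h fh hf] := bf.
have h_neq0 w : w != 0 -> h w != 0.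
  by apply: contraNneq => hw; rewrite -(hf w) hw linear0.
case: k f bf qf h fh hf h_neq0 => [|k] f _ qf h fh hf h_neq0.
  have: const_mx 1 = 0 :> 'rV[F]_(qdim q).
    by rewrite -(fh (const_mx 1)) -[RHS]fh (thinmx0 (f _)) [in RHS](thinmx0 (f _)).
  by move/rowP/(_ (Ordinal q0)); rewrite !mxE => /eqP; rewrite oner_eq0.
pose w : 'rV[F]_(qdim (add_hyperbolic k (qzero F)) + 2) := row_mx 0 (delta_mx 0 0).
have w0 : w != 0.
  apply/eqP => /(congr1 rsubmx); rewrite row_mxKr linear0 => /rowP/(_ 0).
  by rewrite !mxE => /eqP; rewrite oner_eq0.
exists (h w); first exact: h_neq0.
rewrite -qf hf /= row_mxKl row_mxKr qval0 !mxE /=.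
by rewrite mulr0 addr0.
Qed.

Lemma qpfister2E a b (v : 'rV[F]_(2 + 2)) :
  qpfister2 a b v = qnorm a b (lsubmx v 0 0) (lsubmx v 0 1) (rsubmx v 0 0) (rsubmx v 0 1).
Proof. by rewrite /= /qnorm mulNr. Qed.

Lemma rV4_neq0 (v : 'rV[F]_(2 + 2)) : v != 0 ->
  [|| lsubmx v 0 0 != 0, lsubmx v 0 1 != 0, rsubmx v 0 0 != 0 | rsubmx v 0 1 != 0].
Proof.
have r2 (u : 'rV[F]_2) : u 0 0 = 0 -> u 0 1 = 0 -> u = 0.
  move=> u0 u1; apply/rowP; case=> [[|[|//]]] i; rewrite mxE.
  - by rewrite -[RHS]u0; congr (u _ _); apply: val_inj.
  - by rewrite -[RHS]u1; congr (u _ _); apply: val_inj.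
apply: contraNT; rewrite !negb_or !negbK => /and4P[/eqP h1 /eqP h2 /eqP h3 /eqP h4].
by rewrite -[v]hsubmxK (r2 _ h1 h2) (r2 _ h3 h4) row_mx0.
Qed.

(** A nonzero isotropic vector of <<a, b>> - c <<a, b>> yields N1 = c N2 for values
    N1 and N2 of <<a, b>>. If these are nonzero, roundness shows that <<a, b>>
    absorbs c; otherwise <<a, b>> is isotropic, hence zero. *)
Lemma Iq3_pfister3_zero : Iq_trivial F 3 -> pfister3_zero F.
Proof.
move=> I3 a b c a0 b0 c0.
have [//|v v0 qv] := witt_equiv_qzero_isotropic _ (I3 _ (Iq3_pfister3 a0 b0 c0)).
have {qv}: qpfister2 a b (lsubmx v) + - c * qpfister2 a b (rsubmx v) = 0 := qv.
rewrite !qpfister2E mulNr => /eqP; rewrite subr_eq0 => /eqP E.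
have [N20|N20] := eqVneq (qpfister2 a b (rsubmx v)) 0.
  suff -> : pfister2 a b = 0 by rewrite mul0r.
  rewrite !qpfister2E in N20; rewrite N20 mulr0 in E.
  have [l0|l0] := eqVneq (lsubmx v) 0; last exact: pfister2_isotropic E (rV4_neq0 l0).
  have [r0|r0] := eqVneq (rsubmx v) 0; last exact: pfister2_isotropic N20 (rV4_neq0 r0).
  by case/eqP: v0; rewrite -[v]hsubmxK l0 r0 row_mx0.
rewrite qpfister2E in N20.
have N10 := mulf_neq0 c0 N20; rewrite -E in N10.
have := pfister2_norm a0 b0 N10; rewrite E wclass1M mulrCA pfister2_norm // => E'.
by rewrite mulrBr mulr1 mulrC E' subrr.
Qed.

End PfisterForms.

(** * Chain equivalence of presentations *)

Theorem theorem5p2 (F : fieldType) (n : nat)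
  (charF : 2%N \notin [pchar F]%R) (n_ge1 : (1 <= n)%N)
  (I3F : Iq_trivial F 3)
  (p q : presentation F n)
  (iso_pq : isomorphic (tensor_quat p) (tensor_quat q)) :
  connected p q.
Proof.
have char2 : 2%:R != 0 :> F by move: charF; rewrite inE.
have J := Iq3_pfister3_zero char2 I3F.
have p0 : nzsym p := slots_neq0 p; have q0 : nzsym q := slots_neq0 q.
apply: sconn_connected; apply: symbol_sum_sconn => //; first by rewrite !size_tuple.
have q2 : symbol_sum q + symbol_sum q = 0.
  rewrite /symbol_sum -big_split big_seq big1 //= => -[c d] /(allP q0) /= /andP[c0 d0].
  have N10 : -1 != 0 :> F by rewrite oppr_eq0 oner_neq0.
  by rewrite -[RHS](J c d (-1) c0 d0 N10) wclass1N wclass1_1; ring.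
have pq : symbol_sum p + symbol_sum q = 0.
  rewrite -symbol_sum_cat; apply: (split_symbol_sum (m := n + n)) => //.
  - by rewrite /nzsym all_cat; apply/andP.
  - by rewrite size_cat !size_tuple.
  - by have := isomorphic_module iso_pq; rewrite size_tuple.
by apply: (addIr (symbol_sum q)); rewrite pq q2.
Qed.
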